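(* Let $(X, \mathcal{C})$ be a uniformly locally finite coarse space. If $X$ has property A, then the translation C$^*$-algebra (uniform Roe algebra) $C^*_{\mathrm{u}}(X)$ is nuclear.
   Context: For subsets $T, T_1, T_2 \subset X^2$ of the square of a set $X$, write $T^{-1} = \{(x,y) : (y,x) \in T\}$, $T_1 \circ T_2 = \{(x,y) : \exists z \in X,\ (x,z) \in T_1,\ (z,y) \in T_2\}$, and for $x \in X$ write $T[x] = \{y \in X : (y,x) \in T\}$. A coarse structure on $X$ is a family $\mathcal{C}$ of subsets of $X^2$ that contains the diagonal $\Delta_X = \{(x,x) : x \in X\}$ and is closed under $T \mapsto T^{-1}$, under $(T_1,T_2) \mapsto T_1 \circ T_2$, under $(T_1,T_2) \mapsto T_1 \cup T_2$, and under passing to subsets. The pair $(X,\mathcal{C})$ is called a coarse space (it need not be connected or metrizable), and elements of $\mathcal{C}$ are called controlled sets. $(X,\mathcal{C})$ is uniformly locally finite if $\sup_{x \in X} \sharp(T[x]) < \infty$ for every $T \in \mathcal{C}$. A uniformly locally finite coarse space $(X,\mathcal{C})$ has property A if for every $\epsilon > 0$ and every $T \in \mathcal{C}$ there exist $S \in \mathcal{C}$ and a subset $A \subset S \times \mathbb{N}$ (with $\mathbb{N} = \{1,2,\dots\}$) such that, writing $A_x = \{(y,n) \in X \times \mathbb{N} : (x,y,n) \in A\}$: (i) $A_x$ is finite for every $x \in X$; (ii) $\Delta_X \times \{1\} \subset A$; (iii) $\sharp(A_x \bigtriangleup A_y) < \epsilon\, \sharp(A_x \cap A_y)$ whenever $(x,y)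 \in T$, where $\bigtriangleup$ denotes symmetric difference. For a controlled set $T$, let $E_T = \{a \in \mathbb{B}(\ell^2(X)) : \langle a\delta_y, \delta_x\rangle = 0 \text{ if } (x,y) \in X^2 \setminus T\}$. The uniform Roe algebra (translation C$^*$-algebra) $C^*_{\mathrm{u}}(X)$ is the operator-norm closure of $\bigcup_{T \in \mathcal{C}} E_T$ in $\mathbb{B}(\ell^2(X))$. *)

(* Defs.v *)
From HB Require Import structures.
From mathcomp Require Import all_boot all_order all_algebra.
From mathcomp Require Import ring lra.
From mathcomp Require Import finmap complex.
From mathcomp Require Import all_classical all_reals all_analysis.

Set Implicit Arguments.
Unset Strict Implicit.
Unset Printing Implicit Defensive.

Import Order.TTheory GRing.Theory Num.Theory.
Import ComplexField Normc.

Local Open Scope classical_set_scope.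
Local Open Scope ring_scope.
Local Open Scope complex_scope.

Section Sums.
Context {R : realType} {X : choiceType}.
Implicit Types (u v g h : X -> R) (f : X -> R[i]).

Definition rsummable g := summable [set: X] (fun x => (g x)%:E).

(* The sum of a nonnegative family; 0 if that sum is infinite. *)
Definition nnsum u : R := fine (\esum_(x in [set: X]) (u x)%:E)%E.

(* Meaningful for absolutely summable families only, like [csum]. *)
Definition rsum g : R :=
  nnsum (fun x => Num.max (g x) 0) - nnsum (fun x => Num.max (- g x) 0).

Definition csummable f := rsummable (fun x => normc (f x)).

Definition csum f : R[i] :=
  rsum (fun x => complex.Re (f x)) +i* rsum (fun x => complex.Im (f x)).

Lemma rsummable_le g h :
  (forall x, `|g x| <= h x) -> rsummable h -> rsummable g.
Proof.
move=> gh; apply: le_lt_trans; apply: le_esum => x _.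
by rewrite /= lee_fin (le_trans (gh x))// ler_norm.
Qed.

Lemma rsummableD g h :
  rsummable g -> rsummable h -> rsummable (fun x => g x + h x).
Proof. exact: summableD. Qed.

Lemma esumZ (c : R) u : 0 <= c -> (forall x, 0 <= u x) ->
  (\esum_(x in [set: X]) (c * u x)%:E = c%:E * \esum_(x in [set: X]) (u x)%:E)%E.
Proof.
move=> c0 u0; rewrite /esum -ereal_supZl//; last first.
  by apply/set0P; exists 0%E, set0; [exact: fsets_set0|rewrite fsbig_set0].
congr ereal_sup; apply/seteqP; split => [_ [A fA <-]|_ [_ [A fA <-] <-]].
  exists (\sum_(x \in A) (u x)%:E)%E; first by exists A.
  rewrite ge0_mule_fsumr; last by move=> i; rewrite lee_fin.
  by apply: eq_fsbigr => x _; rewrite EFinM.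
exists A => //; rewrite ge0_mule_fsumr; last by move=> i; rewrite lee_fin.
by apply: eq_fsbigr => x _; rewrite EFinM.
Qed.

Lemma rsummableZ (c : R) g : rsummable g -> rsummable (fun x => c * g x).
Proof.
rewrite /rsummable /summable => sg.
rewrite (eq_esum (b := fun x => (`|c| * `|g x|)%:E)); last first.
  by move=> x _; rewrite abse_EFin normrM.
rewrite esumZ// lte_mul_pinfty// ?lee_fin//.
Qed.

Lemma nnsum_fin u : (forall x, 0 <= u x) -> rsummable u ->
  (\esum_(x in [set: X]) (u x)%:E = (nnsum u)%:E)%E.
Proof.
move=> u0 su; rewrite /nnsum fineK// -(eq_esum (a := fun x => `|(u x)%:E|%E)).
  by rewrite -summableE.
by move=> x _; rewrite abse_EFin ger0_norm.
Qed.

Lemma eq_nnsum u v : u =1 v -> nnsum u = nnsum v.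
Proof. by move=> /funext ->. Qed.

Lemma nnsum_ge0 u : (forall x, 0 <= u x) -> 0 <= nnsum u.
Proof. by move=> u0; apply/fine_ge0/esum_ge0 => x _; rewrite lee_fin. Qed.

Lemma nnsumD u v : (forall x, 0 <= u x) -> (forall x, 0 <= v x) ->
  rsummable u -> rsummable v ->
  nnsum (fun x => u x + v x) = nnsum u + nnsum v.
Proof.
move=> u0 v0 su sv; apply: EFin_inj; rewrite -nnsum_fin.
- rewrite EFinD -!nnsum_fin// -esumD// => x _; rewrite lee_fin; exact: u0 || exact: v0.
- by move=> x; rewrite addr_ge0.
- exact: rsummableD.
Qed.

Lemma nnsumZ (c : R) u : 0 <= c -> (forall x, 0 <= u x) -> rsummable u ->
  nnsum (fun x => c * u x) = c * nnsum u.
Proof.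
move=> c0 u0 su; apply: EFin_inj; rewrite -nnsum_fin.
- by rewrite esumZ// EFinM nnsum_fin.
- by move=> x; rewrite mulr_ge0.
- exact: rsummableZ.
Qed.

Lemma rsummable_pos g : rsummable g -> rsummable (fun x => Num.max (g x) 0).
Proof.
move=> sg; apply: (rsummable_le (h := fun x => `|g x|)) => [x|].
  by rewrite ger0_norm ?le_max ?lexx ?orbT// ge_max ler_norm normr_ge0.
apply: le_lt_trans sg; apply: le_esum => x _.
by rewrite /= lee_fin normr_id.
Qed.

Lemma rsummableN g : rsummable g -> rsummable (fun x => - g x).
Proof. by rewrite /rsummable summableN. Qed.

Lemma rsumB u v : (forall x, 0 <= u x) -> (forall x, 0 <= v x) ->
  rsummable u -> rsummable v ->
  rsum (fun x => u x - v x) = nnsum u - nnsum v.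
Proof.
move=> u0 v0 su sv; have sN := rsummableN sv.
have suv : rsummable (fun x => u x - v x) by exact: rsummableD.
have p0 (g : X -> R) x : 0 <= Num.max (g x) 0 by rewrite le_max lexx orbT.
apply/eqP; rewrite /rsum subr_eq addrAC eq_sym subr_eq eq_sym; apply/eqP.
have sp := rsummable_pos suv; have sn := rsummable_pos (rsummableN suv).
rewrite -[LHS]nnsumD//; last exact: p0 (fun x => u x - v x).
rewrite -[RHS]nnsumD//; last exact: p0 (fun x => - (u x - v x)).
apply: eq_nnsum => x; rewrite opprB.
by case: (leP (u x - v x) 0); case: (leP (v x - u x) 0); lra.
Qed.

Lemma rsumE g : rsummable g ->
  exists u v, [/\ forall x, 0 <= u x, forall x, 0 <= v x, rsummable u,
    rsummable v & forall x, g x = u x - v x].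
Proof.
move=> sg; exists (fun x => Num.max (g x) 0), (fun x => Num.max (- g x) 0).
split.
- by move=> x; rewrite le_max lexx orbT.
- by move=> x; rewrite le_max lexx orbT.
- exact: rsummable_pos.
- exact/rsummable_pos/rsummableN.
- by move=> x; case: (leP (g x) 0); case: (leP (- g x) 0); lra.
Qed.

Lemma rsumD g h : rsummable g -> rsummable h ->
  rsum (fun x => g x + h x) = rsum g + rsum h.
Proof.
move=> /rsumE[u [v [u0 v0 su sv /funext ->]]].
move=> /rsumE[u' [v' [u0' v0' su' sv' /funext ->]]].
transitivity (rsum (fun x => (u x + u' x) - (v x + v' x))).
  by congr rsum; apply/funext => x; lra.
rewrite !rsumB ?nnsumD//; first lra.
- by move=> x; rewrite addr_ge0.
- by move=> x; rewrite addr_ge0.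
- exact: rsummableD.
- exact: rsummableD.
Qed.

Lemma rsumN g : rsum (fun x => - g x) = - rsum g.
Proof.
by rewrite /rsum opprB; congr (_ - _); apply: eq_nnsum => x; rewrite opprK.
Qed.

Lemma rsumZ (c : R) g : rsummable g -> rsum (fun x => c * g x) = c * rsum g.
Proof.
move=> /rsumE[u [v [u0 v0 su sv /funext ->]]].
wlog c0 : c / 0 <= c.
  move=> H; have [/H//|c0] := leP 0 c.
  have /H : 0 <= - c by rewrite oppr_ge0 ltW.
  rewrite mulNr => /(congr1 -%R); rewrite opprK => <-.
  by rewrite -rsumN; congr rsum; apply/funext => x; rewrite mulNr opprK.
rewrite rsumB// mulrBr -!nnsumZ// -rsumB//; try exact: rsummableZ.
- by congr rsum; apply/funext => x; rewrite mulrBr.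
- by move=> x; rewrite mulr_ge0.
- by move=> x; rewrite mulr_ge0.
Qed.

Lemma normc_ge0 (z : R[i]) : 0 <= normc z.
Proof. by case: z => a b /=; rewrite sqrtr_ge0. Qed.

Lemma sqr_normcE (z : R[i]) :
  normc z ^+ 2 = complex.Re z ^+ 2 + complex.Im z ^+ 2.
Proof. by case: z => a b /=; rewrite sqr_sqrtr// addr_ge0// sqr_ge0. Qed.

Lemma ler_Re_normc (z : R[i]) : `|complex.Re z| <= normc z.
Proof.
rewrite -(@ler_pXn2r _ 2)// ?nnegrE ?normc_ge0// real_normK ?num_real//.
by rewrite sqr_normcE lerDl sqr_ge0.
Qed.

Lemma ler_Im_normc (z : R[i]) : `|complex.Im z| <= normc z.
Proof.
rewrite -(@ler_pXn2r _ 2)// ?nnegrE ?normc_ge0// real_normK ?num_real//.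
by rewrite sqr_normcE lerDr sqr_ge0.
Qed.

Lemma csummable_Re f : csummable f -> rsummable (fun x => complex.Re (f x)).
Proof. by apply: rsummable_le => x; exact: ler_Re_normc. Qed.

Lemma csummable_Im f : csummable f -> rsummable (fun x => complex.Im (f x)).
Proof. by apply: rsummable_le => x; exact: ler_Im_normc. Qed.

Lemma csumD f1 f2 : csummable f1 -> csummable f2 ->
  csum (fun x => f1 x + f2 x) = csum f1 + csum f2.
Proof.
move=> s1 s2; rewrite /csum; apply/eqP; rewrite eq_complex/=; apply/andP.
split; apply/eqP; rewrite -rsumD; try exact: csummable_Re;
  try exact: csummable_Im.
- by congr rsum; apply/funext => x; case: (f1 x) => ? ?; case: (f2 x).
- by congr rsum; apply/funext => x; case: (f1 x) => ? ?; case: (f2 x).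
Qed.

Lemma csumZ (c : R[i]) f : csummable f ->
  csum (fun x => c * f x) = c * csum f.
Proof.
move=> sf; have sr := csummable_Re sf; have si := csummable_Im sf.
rewrite /csum; case: c => a b; apply/eqP; rewrite eq_complex/=; apply/andP.
split; apply/eqP.
  rewrite -!rsumZ// -rsumN -rsumD; [|exact: rsummableZ|].
    by congr rsum; apply/funext => x; case: (f x).
  exact/rsummableN/rsummableZ.
rewrite -!rsumZ// -rsumD; [|exact: rsummableZ|exact: rsummableZ].
by congr rsum; apply/funext => x; case: (f x).
Qed.

Lemma csum_conj f : csum (fun x => (f x)^*) = (csum f)^*.
Proof.
apply/eqP; rewrite eq_complex/=; apply/andP; split; apply/eqP.
  by congr rsum; apply/funext => x; case: (f x).
by rewrite -rsumN; congr rsum; apply/funext => x; case: (f x).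
Qed.

Lemma nnsum1 (a : X) u : (forall x, 0 <= u x) -> (forall x, x != a -> u x = 0) ->
  nnsum u = u a.
Proof.
move=> u0 ua; rewrite /nnsum (esumID [set a]); last first.
  by move=> x _; rewrite lee_fin.
rewrite !setTI esum_set1 ?lee_fin// esum1 ?adde0// => x /= /eqP xa.
by rewrite ua.
Qed.

Lemma csum1 (a : X) f : (forall x, x != a -> f x = 0) -> csum f = f a.
Proof.
have H (g : X -> R) : (forall x, x != a -> g x = 0) -> rsum g = g a.
  move=> ga; rewrite /rsum !(@nnsum1 a).
  - by case: (leP (g a) 0); case: (leP (- g a) 0); lra.
  - by move=> x; rewrite le_max lexx orbT.
  - by move=> x /ga ->; rewrite oppr0 maxxx.
  - by move=> x; rewrite le_max lexx orbT.
  - by move=> x /ga ->; rewrite maxxx.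
move=> fa; rewrite /csum !H => [|x /fa ->|x /fa ->]//; by case: (f a).
Qed.

End Sums.

Section Ell2.
Variables (R : realType) (X : choiceType).

Definition sqsummable : {pred X -> R[i]} :=
  fun f => `[< rsummable (fun x => normc (f x) ^+ 2) >].

Record ell2 := Ell2 { ell2_val :> X -> R[i]; _ : ell2_val \in sqsummable }.

HB.instance Definition _ := [isSub for ell2_val].
HB.instance Definition _ := [Choice of ell2 by <:].

Lemma sqsummableP (f : ell2) : rsummable (fun x => normc (f x) ^+ 2).
Proof. by have /asboolP := valP f. Qed.

Lemma ler_normcD2 (a b : R[i]) :
  normc (a + b) ^+ 2 <= 2 * normc a ^+ 2 + 2 * normc b ^+ 2.
Proof.
have := sqr_ge0 (normc a - normc b).
have : normc (a + b) ^+ 2 <= (normc a + normc b) ^+ 2.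
  by rewrite ler_pXn2r// ?nnegrE ?addr_ge0 ?normc_ge0// le_normcD.
by nra.
Qed.

Lemma sqsummable_submod_closed : submod_closed sqsummable.
Proof.
split.
  apply/asboolP; rewrite /rsummable /summable esum1// => x _.
  by rewrite /= expr0n/= addr0 sqrtr0 expr0n/= normr0.
move=> c f g /asboolP sf /asboolP sg; apply/asboolP.
have sh := rsummableD (rsummableZ (2 * normc c ^+ 2) sf) (rsummableZ 2 sg).
apply: rsummable_le sh => x; rewrite ger0_norm ?sqr_ge0//.
by rewrite (le_trans (ler_normcD2 _ _))// normcM exprMn mulrA.
Qed.

HB.instance Definition _ := GRing.isSubmodClosed.Build _ _ sqsummable
  sqsummable_submod_closed.
HB.instance Definition _ := [SubChoice_isSubLmodule of ell2 by <:].

Definition l2dot (f g : ell2) : R[i] := csum (fun x => f x * (g x)^*).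

Lemma normc_conj (z : R[i]) : normc z^* = normc z.
Proof. by case: z => a b /=; rewrite sqrrN. Qed.

Lemma csummable_dot (f g : ell2) : csummable (fun x => f x * (g x)^*).
Proof.
have := rsummableD (sqsummableP f) (sqsummableP g).
apply: rsummable_le => x; rewrite ger0_norm ?normc_ge0//.
rewrite normcM normc_conj.
have := sqr_ge0 (normc (f x) - normc (g x)).
have := mulr_ge0 (normc_ge0 (f x)) (normc_ge0 (g x)).
by nra.
Qed.

Lemma l2dot_linearl g : GRing.linear_for *%R (l2dot^~ g).
Proof.
move=> c f h; rewrite /l2dot -csumZ; last exact: csummable_dot.
rewrite -csumD; last exact: csummable_dot.
  by congr csum; apply/funext => x; rewrite /= mulrDl mulrA.
have := csummable_dot (c *: f) g; congr csummable; apply/funext => x /=.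
by rewrite mulrA.
Qed.

Lemma l2dotC f g : l2dot f g = (l2dot g f)^*.
Proof.
rewrite /l2dot -csum_conj; congr csum; apply/funext => x.
by rewrite rmorphM /= conjcK mulrC.
Qed.

Lemma l2dot_linearr f : GRing.linear_for (Num.conj \; *%R) (l2dot f).
Proof.
move=> c g h; by rewrite l2dotC l2dot_linearl rmorphD rmorphM/= (l2dotC f g) (l2dotC f h).
Qed.

Lemma l2dotE f : l2dot f f = (nnsum (fun x => normc (f x) ^+ 2))%:C.
Proof.
rewrite /l2dot /csum; apply/eqP; rewrite eq_complex/=; apply/andP.
have E x : f x * (f x)^* = (normc (f x) ^+ 2)%:C.
  by rewrite -sqr_normc normc_def sqr_normcE -rmorphXn/= sqr_sqrtr// addr_ge0// sqr_ge0.
have Z : nnsum (fun _ : X => 0 : R) = 0 by rewrite /nnsum esum1.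
split; apply/eqP; rewrite /rsum.
  rewrite [X in _ - X](_ : _ = 0) ?subr0; last first.
    by rewrite -[RHS]Z; apply: eq_nnsum => x; rewrite E/= max_r// oppr_le0 sqr_ge0.
  by apply: eq_nnsum => x; rewrite E/= max_l// sqr_ge0.
rewrite -[RHS](subrr (nnsum (fun _ : X => 0 : R))).
by congr (_ - _); apply: eq_nnsum => x; rewrite E/= ?oppr0 maxxx.
Qed.

Lemma l2dot_gt0 f : f != 0 -> 0 < l2dot f f.
Proof.
move=> f0; rewrite l2dotE ltcR lt_neqAle nnsum_ge0 ?andbT//; last first.
  by move=> x; rewrite sqr_ge0.
apply: contra f0 => /eqP e; apply/eqP/val_inj/funext => x /=.
apply: eq0_normc; apply/eqP; rewrite -sqrf_eq0 eq_le sqr_ge0 andbT.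
have := @nnsum_fin R X (fun x => normc (f x) ^+ 2) (fun=> sqr_ge0 _)
  (sqsummableP f).
rewrite -e (esumID [set x]); last by move=> y _; rewrite lee_fin sqr_ge0.
rewrite setTI esum_set1 ?lee_fin ?sqr_ge0// => h.
by rewrite -lee_fin -h leeDl// esum_ge0// => y _; rewrite lee_fin sqr_ge0.
Qed.

HB.instance Definition _ := @bilinear_isBilinear.Build R[i] ell2 ell2 R[i]
  *%R (Num.conj \; *%R) l2dot (l2dot_linearl, l2dot_linearr).

Fact l2dot_hermitian f g : l2dot f g = (-1) ^+ false * Num.conj (l2dot g f).
Proof. by rewrite mul1r l2dotC. Qed.

HB.instance Definition _ := @isHermitianSesquilinear.Build R[i] ell2 false
  Num.conj l2dot l2dot_hermitian.
HB.instance Definition _ := @isDotProduct.Build R[i] ell2 l2dot l2dot_gt0.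

Definition delta_fun (x : X) : X -> R[i] := fun y => (y == x)%:R.

Fact delta_subproof x : delta_fun x \in sqsummable.
Proof.
apply/asboolP; rewrite /rsummable /summable (esumID [set x])//.
rewrite setTI esum_set1// esum1 ?adde0 ?ltry// => y /= [_ /eqP yx].
by rewrite /delta_fun (negbTE yx) normc0 expr0n/= normr0.
Qed.

Definition delta (x : X) : ell2 := Ell2 (delta_subproof x).

Lemma l2dot_delta f x : l2dot f (delta x) = f x.
Proof.
rewrite /l2dot (@csum1 _ _ x) => [|y yx] /=; rewrite /delta_fun.
  by rewrite eqxx rmorph1 mulr1.
by rewrite (negbTE yx) rmorph0 mulr0.
Qed.

End Ell2.

Arguments l2dot {R X}.
Arguments delta {R X}.

Section Operators.
Context {R : realType} {V : lmodType R[i]} (dot : {dot V for Num.conj}).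

Definition hnorm (v : V) : R := Num.sqrt (complex.Re (dot v v)).

Definition opnorm (a : V -> V) : \bar R :=
  ereal_sup [set (hnorm (a v))%:E | v in [set v | hnorm v <= 1]].

Definition bounded_operators : set (V -> V) :=
  [set a | linear a /\ (opnorm a < +oo)%E].

(* Positivity of [a] in M_n(B(V)) = B(V^n): <a v, v> >= 0 for all v in V^n. In
   the order of R[i], 0 <= z says that z is real and nonnegative. *)
Definition positive_mx n (a : 'M[V -> V]_n) : Prop :=
  forall v : 'I_n -> V, 0 <= \sum_i \sum_j dot (a i j (v j)) (v i).

End Operators.

Section CompletelyPositive.
Context {R : realType} {V W : lmodType R[i]}.
Variables (dotV : {dot V for Num.conj}) (dotW : {dot W for Num.conj}).

(* Only the values of [phi] on [A] matter. *)
Record contractive_completely_positive (A : set (V -> V)) (B : set (W -> W))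
    (phi : (V -> V) -> (W -> W)) : Prop := CCP {
  ccp_maps : forall a, A a -> B (phi a);
  ccp_linear : forall (c : R[i]) a b, A a -> A b ->
    phi (c *: a + b) = c *: phi a + phi b;
  ccp_positive : forall n (a : 'M[V -> V]_n), (forall i j, A (a i j)) ->
    positive_mx dotV a -> positive_mx dotW (map_mx phi a);
  ccp_contractive : forall a, A a -> (opnorm dotW (phi a) <= opnorm dotV a)%E
}.

End CompletelyPositive.

Section MatrixAlgebra.
Variables (R : realType) (k : nat).

Definition cvdot (u v : 'cV[R[i]]_k) : R[i] := dotmx u^T v^T.

Fact cvdot_bilinear : bilinear_for *%R (Num.conj \; *%R) cvdot.
Proof.
split=> u c v w; rewrite /cvdot linearP/=; first exact: linearPl.
exact: linearPr.
Qed.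

HB.instance Definition _ := @bilinear_isBilinear.Build R[i] 'cV[R[i]]_k
  'cV[R[i]]_k R[i] *%R (Num.conj \; *%R) cvdot cvdot_bilinear.

Fact cvdot_hermitian u v : cvdot u v = (-1) ^+ false * Num.conj (cvdot v u).
Proof. exact: hermitian_subproof. Qed.

HB.instance Definition _ := @isHermitianSesquilinear.Build R[i] 'cV[R[i]]_k
  false Num.conj cvdot cvdot_hermitian.

Fact cvdot_gt0 u : u != 0 -> 0 < cvdot u u.
Proof. by move=> u0; apply: neq0_dnorm_gt0; rewrite trmx_eq0. Qed.

HB.instance Definition _ := @isDotProduct.Build R[i] 'cV[R[i]]_k cvdot cvdot_gt0.

(* M_k(C), acting on C^k. *)
Definition matrix_algebra : set ('cV[R[i]]_k -> 'cV[R[i]]_k) :=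
  range (fun M : 'M[R[i]]_k => mulmx M : 'cV[R[i]]_k -> 'cV[R[i]]_k).

End MatrixAlgebra.

Arguments cvdot {R} k u v.
Arguments matrix_algebra R k : clear implicits.

(* Completely positive approximation property of a C*-algebra [A] of bounded
   operators. The finite sets [F] and the [eps] index the net of factorizations
   of the identity of [A] through matrix algebras, converging in point-norm. *)
Definition nuclear {R : realType} {V : lmodType R[i]}
    (dot : {dot V for Num.conj}) (A : set (V -> V)) : Prop :=
  forall (F : set (V -> V)) (eps : R), finite_set F -> F `<=` A -> 0 < eps ->
  exists (k : nat) (phi : (V -> V) -> ('cV[R[i]]_k -> 'cV[R[i]]_k))
    (psi : ('cV[R[i]]_k -> 'cV[R[i]]_k) -> (V -> V)),
    [/\ (0 < k)%N,
      contractive_completely_positive dot (cvdot k) A (matrix_algebra R k) phi,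
      contractive_completely_positive (cvdot k) dot (matrix_algebra R k) A psi &
      forall a, F a -> (opnorm dot (psi (phi a) - a)%R < eps%:E)%E].

Section Coarse.
Variable X : choiceType.
Implicit Types (T : set (X * X)) (C : set (set (X * X))).

Record coarse_structure C : Prop := CoarseStructure {
  coarse_diagonal : C diagonal;
  coarse_inv : forall T, C T -> C (T^-1)%relation;
  coarse_comp : forall T1 T2, C T1 -> C T2 ->
    C [set p | exists z, T1 (p.1, z) /\ T2 (z, p.2)];
  coarse_union : forall T1 T2, C T1 -> C T2 -> C (T1 `|` T2);
  coarse_sub : forall T1 T2, T1 `<=` T2 -> C T2 -> C T1
}.

Definition uniformly_locally_finite C : Prop :=
  forall T, C T -> exists N : nat, forall x : X, (ysection T x #<= `I_N)%card.

Definition slice (A : set (X * X * nat)) (x : X) : set (X * nat) :=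
  [set p | A (x, p.1, p.2)].

Definition propertyA (R : realType) C : Prop :=
  forall (eps : R) T, 0 < eps -> C T ->
  exists (S : set (X * X)) (A : set (X * X * nat)),
    [/\ C S /\ A `<=` S `*` [set n | (1 <= n)%N],
      forall x, finite_set (slice A x),
      forall x, A (x, x, 1%N) &
      forall x y, T (x, y) ->
        #|` fset_set (slice A x `+` slice A y) |%:R
          < eps * #|` fset_set (slice A x `&` slice A y) |%:R].

Definition band_operators (R : realType) T : set (ell2 R X -> ell2 R X) :=
  [set a | bounded_operators l2dot a /\
    forall x y, ~ T (x, y) -> l2dot (a (delta y)) (delta x) = 0].

Definition uniform_roe_algebra (R : realType) C : set (ell2 R X -> ell2 R X) :=
  [set a | bounded_operators l2dot a /\
    forall eps : R, 0 < eps -> exists T b,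
      [/\ C T, band_operators T b & (opnorm l2dot (a - b)%R < eps%:E)%E]].

End Coarse.

Arguments band_operators {X} R T.
Arguments uniform_roe_algebra {X} R C.

(* Main.v *)
From HB Require Import structures.
Require Import Defs.
From mathcomp Require Import all_boot all_order all_algebra.
From mathcomp Require Import ring lra.
From mathcomp Require Import finmap complex.
From mathcomp Require Import all_classical all_reals all_analysis.

(** Property A gives, for each point [x], a nonempty finite set [L x] of labels
in [W], here the slice [A_x] inside [X * nat], such that nearby points have
slices that almost agree, and such that the points sharing a label [w] form a
set [M w] of bounded size. With [c x = 1 / sqrt #(L x)], the map
[f |-> (V_w f)_w], where [V_w f] is the restriction of [c * f] to [M w], is an
isometry from l2(X) to the direct sum of the spaces l2(M w), because
[(c x)^2 #(L x) = 1]. Compressing an operator [a] to all the sets [M w] and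
then pulling back by this isometry multiplies the matrix entry [(x, y)] of [a]
by [c x * c y * #(L x :&: L y)]. On the controlled set where property A was
applied this factor is close to 1, so the composite is close to the identity on
band operators, in norm since rows and columns have boundedly many nonzero
entries.

The compressions [(a_w)_w] live in a product of matrix algebras of bounded
size, in general over infinitely many [w], and only a finite number of them can be kept.
For the finitely many band operators at stake the entries of [a_w] are bounded,
so the labels [w] split into finitely many classes [kappa w] on which these
entries are nearly constant. The first map ([compress]) therefore keeps the
compression to one representative of each class, a block diagonal matrix; the
second map ([spread]) uses, at the label [w], the block of the class of [w].

[compress] is a direct sum of compressions, hence positive by inspection, and
contractive by Bessel's inequality ([bessel], [synthesis_le]). [spread] is
[g |-> sum_w V_w^* g V_w]: positivity follows from [spread_dot], which exchanges
the sums over points and labels, and contractivity from the Cauchy-Schwarz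
inequality over [L x] ([averaging_le]) and the isometry property
([esum_weight]). The values of [spread] are supported where [L x] meets [L y],
a controlled set. The estimate on band operators is [approx_le]; contractivity
of both maps then transfers it to the whole algebra ([opnorm_perturbation]). *)

Set Implicit Arguments.
Unset Strict Implicit.
Unset Printing Implicit Defensive.

Import Order.TTheory GRing.Theory Num.Theory.
Import ComplexField Normc.

Local Open Scope classical_set_scope.
Local Open Scope ring_scope.
Local Open Scope complex_scope.

(** * Hilbert space norms and operator norms *)

(** The operators at hand are bare functions with a proof of linearity; the next
lemmas give them the linear algebra that the bundled morphisms have. *)
Lemma linear_sumZ (F : nzRingType) (U V : lmodType F) (a : U -> V) (I : Type)
    (s : seq I) (c : I -> F) (u : I -> U) :
  linear a -> a (\sum_(i <- s) c i *: u i) = \sum_(i <- s) c i *: a (u i).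
Proof.
move=> al; pose aL : {linear U -> V} := HB.pack a (GRing.isLinear.Build _ _ _ _ a al).
by rewrite -[a]/(aL : U -> V) linear_sum; apply: eq_bigr => i _; rewrite linearZ.
Qed.

Lemma linear_subE (F : nzRingType) (U V : lmodType F) (a : U -> V) (u v : U) :
  linear a -> a (u - v) = a u - a v.
Proof.
move=> al; pose aL : {linear U -> V} := HB.pack a (GRing.isLinear.Build _ _ _ _ a al).
exact: (linearB aL).
Qed.

Lemma linear_sub (F : nzRingType) (U V : lmodType F) (a b : U -> V) :
  linear a -> linear b -> linear (a - b).
Proof.
move=> al bl c u v; rewrite -[LHS]/(a _ - b _) al bl.
rewrite -[(a - b) u]/(a u - b u) -[(a - b) v]/(a v - b v).
by rewrite scalerBr opprD addrACA.
Qed.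

Lemma real_complexM (R : realType) (x y : R) : (x * y)%:C = x%:C * y%:C.
Proof. exact: rmorphM. Qed.

Lemma normc_real (R : realType) (x : R) : normc x%:C = `|x|.
Proof. by rewrite /= expr0n addr0 sqrtr_sqr. Qed.

Section Hilbert.
Context {R : realType} {V : lmodType R[i]} (dot : {dot V for Num.conj}).
Implicit Types (u v : V) (a : V -> V) (r : R).

Lemma dot_self v : dot v v = (hnorm dot v ^+ 2)%:C.
Proof.
have := dnorm_ge0 dot v; rewrite /hnorm.
by case: (dot v v) => x y; rewrite lecE /= => /andP[/eqP-> x0]; rewrite sqr_sqrtr.
Qed.

Lemma hnorm_ge0 v : 0 <= hnorm dot v. Proof. exact: sqrtr_ge0. Qed.

Lemma hnorm_eq0 v : (hnorm dot v == 0) = (v == 0).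
Proof. by rewrite -(dnorm_eq0 dot) dot_self eq_complex /= eqxx andbT sqrf_eq0. Qed.

Lemma hnorm0 : hnorm dot 0 = 0. Proof. by apply/eqP; rewrite hnorm_eq0. Qed.

Lemma hnormZ (c : R[i]) v : hnorm dot (c *: v) = normc c * hnorm dot v.
Proof.
apply/eqP; rewrite -(@eqrXn2 _ 2)// ?mulr_ge0 ?hnorm_ge0 ?normc_ge0//.
apply/eqP/(@complexI R); rewrite -dot_self dnormZ dot_self -add_Re2_Im2.
by rewrite -sqr_normcE exprMn !real_complexM.
Qed.

Lemma hnorm_sqrD u v : hnorm dot (u + v) ^+ 2 =
  hnorm dot u ^+ 2 + hnorm dot v ^+ 2 + 2 * complex.Re (dot u v).
Proof.
have := dnormD dot u v; rewrite /= !dot_self => /(congr1 (@complex.Re R)) /= ->.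
by case: (dot u v) => x y /=; lra.
Qed.

(** Half of the Cauchy-Schwarz inequality, from the nonnegativity of the norm of
[|v| u - |u| v]; it is all that the triangle inequality needs, and the space need
not be finite-dimensional. *)
Lemma Re_dot_le u v : complex.Re (dot u v) <= hnorm dot u * hnorm dot v.
Proof.
have [/eqP|u0] := boolP (hnorm dot u == 0).
  by move=> /eqP; rewrite hnorm_eq0 => /eqP ->; rewrite linear0l hnorm0 mul0r.
have [/eqP|v0] := boolP (hnorm dot v == 0).
  by move=> /eqP; rewrite hnorm_eq0 => /eqP ->; rewrite linear0r hnorm0 mulr0.
set p := hnorm dot u in u0 *; set q := hnorm dot v in v0 *.
have p0 : 0 < p by rewrite lt_neqAle eq_sym u0 hnorm_ge0.
have q0 : 0 < q by rewrite lt_neqAle eq_sym v0 hnorm_ge0.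
have := sqr_ge0 (hnorm dot (q%:C *: u + (- p)%:C *: v)).
rewrite hnorm_sqrD !hnormZ -/p -/q.
have -> : dot (q%:C *: u) ((- p)%:C *: v) = (- (p * q))%:C * dot u v.
  rewrite linearZl_LR linearZr_LR /= mulrA; congr (_ * _).
  by apply/eqP; rewrite eq_complex/=; apply/andP; split; apply/eqP; ring.
rewrite !normc_real normrN !gtr0_norm//.
case: (dot u v) => x y /=; rewrite mul0r subr0.
have pq : 0 < p * q by rewrite mulr_gt0.
move=> H; rewrite -(ler_pM2l pq); nra.
Qed.

Lemma ler_hnormD u v : hnorm dot (u + v) <= hnorm dot u + hnorm dot v.
Proof.
rewrite -(@ler_pXn2r _ 2)// ?nnegrE ?addr_ge0 ?hnorm_ge0//.
rewrite hnorm_sqrD; have := Re_dot_le u v; nra.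
Qed.

Lemma opnorm_le a r : 0 <= r ->
  (forall v, hnorm dot (a v) <= r * hnorm dot v) -> (opnorm dot a <= r%:E)%E.
Proof.
move=> r0 ar; apply: ge_ereal_sup => _ [v /= v1 <-]; rewrite lee_fin.
by rewrite (le_trans (ar v))// -[leRHS]mulr1 ler_wpM2l.
Qed.

Lemma opnorm_ge0 a : (0 <= opnorm dot a)%E.
Proof.
apply: (@le_trans _ _ (hnorm dot (a 0))%:E); first by rewrite lee_fin hnorm_ge0.
by apply: ereal_sup_ubound; exists 0 => //=; rewrite hnorm0.
Qed.

Lemma opnorm_bound a r v : linear a -> (opnorm dot a <= r%:E)%E ->
  hnorm dot (a v) <= r * hnorm dot v.
Proof.
move=> la ar.
have a0 : a 0 = 0.
  have := la 1 0 0; rewrite !scale1r addr0 => /eqP.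
  by rewrite -subr_eq0 opprD addrA subrr sub0r oppr_eq0 => /eqP.
have aZ c u : a (c *: u) = c *: a u.
  by have := la c u 0; rewrite addr0 a0 addr0.
have [/eqP|v0] := boolP (hnorm dot v == 0).
  move=> /eqP; rewrite hnorm_eq0 => /eqP ->.
  by rewrite a0 hnorm0 mulr0.
have p0 : 0 < hnorm dot v by rewrite lt_neqAle eq_sym v0 hnorm_ge0.
have nc : normc (hnorm dot v)^-1%:C = (hnorm dot v)^-1.
  by rewrite normc_real gtr0_norm// invr_gt0.
have : ((hnorm dot (a ((hnorm dot v)^-1%:C *: v)))%:E <= r%:E)%E.
  apply: le_trans ar; apply: ereal_sup_ubound; exists ((hnorm dot v)^-1%:C *: v) => //=.
  by rewrite hnormZ nc mulVf.
by rewrite aZ hnormZ nc lee_fin mulrC ler_pdivrMr.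
Qed.

Lemma bounded_opP a : linear a -> (opnorm dot a < +oo)%E ->
  exists2 r, opnorm dot a = r%:E & 0 <= r /\
    forall v, hnorm dot (a v) <= r * hnorm dot v.
Proof.
move=> la afin; have a0 := opnorm_ge0 a.
have fin : opnorm dot a \is a fin_num by rewrite ge0_fin_numE.
exists (fine (opnorm dot a)); first by rewrite fineK.
split=> [|v]; first exact: fine_ge0.
by apply: opnorm_bound => //; rewrite fineK.
Qed.

End Hilbert.

Lemma mx_linearE (R : realType) k (g : 'cV[R[i]]_k -> 'cV[R[i]]_k) :
  linear g -> matrix_algebra R k g.
Proof.
move=> lg; pose gl : {linear 'cV[R[i]]_k -> 'cV[R[i]]_k} :=
  HB.pack g (GRing.isLinear.Build _ _ _ _ g lg).
exists (\matrix_(i, j) gl (delta_mx j 0) i 0) => //; apply/funext => v.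
rewrite -[g v]/(gl v) {2}[v]matrix_sum_delta linear_sum.
apply/matrixP => i j; rewrite !mxE summxE; apply: eq_bigr => l _.
rewrite big_ord1 linearZ /= !mxE ord1 mulrC; congr (_ * _).
Qed.

(** * Sums over relations with finite sections *)

Lemma normc_sum_le (R : realType) (I : Type) (s : seq I) (f : I -> R[i]) :
  normc (\sum_(i <- s) f i) <= \sum_(i <- s) normc (f i).
Proof.
elim: s => [|i s IH]; first by rewrite !big_nil normc0.
by rewrite !big_cons (le_trans (le_normcD _ _))// lerD2l.
Qed.


Lemma rsummable_ge0E (R : realType) (X : choiceType) (u : X -> R) :
  (forall x, 0 <= u x) ->
  rsummable u = (\esum_(x in [set: X]) (u x)%:E < +oo)%E.
Proof.
move=> u0; rewrite /rsummable /summable; congr (_ < _)%E.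
by apply: eq_esum => x _; rewrite abse_EFin ger0_norm.
Qed.

Lemma sqr_sum_le (R : realType) (I : Type) (s : seq I) (u : I -> R) :
  (\sum_(i <- s) u i) ^+ 2 <= (size s)%:R * \sum_(i <- s) u i ^+ 2.
Proof.
elim: s => [|i s IH]; first by rewrite !big_nil expr0n mul0r.
rewrite !big_cons /= -natr1.
set A := \sum_(j <- s) u j in IH *; set B := \sum_(j <- s) u j ^+ 2 in IH *.
have B0 : 0 <= B by apply: sumr_ge0 => j _; exact: sqr_ge0.
have [s0|s0] := eqVneq (size s) 0%N.
  have -> : A = 0 by rewrite /A (size0nil s0) big_nil.
  by rewrite s0; nra.
have n0 : 0 < (size s)%:R :> R by rewrite ltr0n lt0n.
set n : R := (size s)%:R in n0 IH *.
have : n * (2 * u i * A) <= n * (n * u i ^+ 2 + B).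
  have := sqr_ge0 (n * u i - A); have := ler_wpM2l (ltW n0) IH; nra.
by rewrite ler_pM2l//; nra.
Qed.

Section Exchange.
Context {R : realType} {X W : choiceType}.
Variables (L : X -> {fset W}) (M : W -> {fset X}).
Hypothesis LM : forall x w, (w \in L x) = (x \in M w).

(** Tonelli for sums over the pairs of a relation whose sections, [L x] and
[M w], are finite. *)
Lemma esum_exchange (u : X -> W -> R) : (forall x w, 0 <= u x w) ->
  (\esum_(x in [set: X]) (\sum_(w <- L x) u x w)%:E =
   \esum_(w in [set: W]) (\sum_(x <- M w) u x w)%:E)%E.
Proof.
have fE (T : choiceType) (A : {fset T}) (f : T -> R) : (forall t, 0 <= f t) ->
    ((\sum_(t <- A) f t)%:E = \esum_(t in [set` A]) (f t)%:E)%E.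
  move=> f0; rewrite esum_fset//; last by move=> i _; rewrite lee_fin.
  by rewrite fsbig_finite//= set_fsetK sumEFin.
move=> u0.
under eq_esum do rewrite fE//.
under [in RHS]eq_esum do rewrite fE//.
rewrite !esum_esum//; try by move=> *; rewrite lee_fin.
rewrite (reindex_esum ([set: W] `*`` (fun w => [set` M w])) _
  (fun p : W * X => (p.2, p.1))).
  exact: eq_esum.
split=> [[w x] /= [_ xM]|[w x] [w' x'] _ _ [-> ->]//|[x w] /= [_ wL]].
  by split=> //; rewrite LM.
by exists (w, x) => //=; split=> //; rewrite -LM.
Qed.

(** Fubini: positive and negative parts reduce it to nonnegative families. *)
Lemma rsum_exchange (g : X -> W -> R) :
  rsummable (fun x => \sum_(w <- L x) `|g x w|) ->
  rsum (fun x => \sum_(w <- L x) g x w) = rsum (fun w => \sum_(x <- M w) g x w).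
Proof.
move=> sg.
pose p x w := Num.max (g x w) 0; pose q x w := Num.max (- g x w) 0.
have p0 x w : 0 <= p x w by rewrite le_max lexx orbT.
have q0 x w : 0 <= q x w by rewrite le_max lexx orbT.
have gE x w : g x w = p x w - q x w.
  by rewrite /p /q; case: (leP (g x w) 0); case: (leP (- g x w) 0); lra.
have pg x w : p x w <= `|g x w| by rewrite ge_max ler_norm normr_ge0.
have qg x w : q x w <= `|g x w| by rewrite ge_max -normrN ler_norm normr_ge0.
have sL (u : X -> W -> R) : (forall x w, 0 <= u x w) ->
    (forall x w, u x w <= `|g x w|) -> rsummable (fun x => \sum_(w <- L x) u x w).
  move=> u0 ug; apply: (rsummable_le _ sg) => x.
  by rewrite ger0_norm ?sumr_ge0//; apply: ler_sum.
have sM (u : X -> W -> R) : (forall x w, 0 <= u x w) ->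
    (forall x w, u x w <= `|g x w|) -> rsummable (fun w => \sum_(x <- M w) u x w).
  move=> u0 ug; have := sL u u0 ug.
  by rewrite !rsummable_ge0E ?esum_exchange// => x; exact: sumr_ge0.
transitivity (rsum (fun x => \sum_(w <- L x) p x w - \sum_(w <- L x) q x w)).
  by congr rsum; apply/funext => x; rewrite -sumrB; apply: eq_bigr.
transitivity (rsum (fun w => \sum_(x <- M w) p x w - \sum_(x <- M w) q x w)).
  rewrite !rsumB//; try (by move=> x; apply: sumr_ge0); try exact: sL; try exact: sM.
  by rewrite /nnsum !esum_exchange.
by congr rsum; apply/funext => w; rewrite -sumrB; apply: eq_bigr.
Qed.

Lemma csum_exchange (h : X -> W -> R[i]) :
  rsummable (fun x => \sum_(w <- L x) normc (h x w)) ->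
  csum (fun x => \sum_(w <- L x) h x w) = csum (fun w => \sum_(x <- M w) h x w).
Proof.
move=> sh; rewrite /csum; congr Complex.
  transitivity (rsum (fun x => \sum_(w <- L x) complex.Re (h x w))).
    by congr rsum; apply/funext => x; rewrite (raddf_sum (@complex.Re R)).
  rewrite rsum_exchange.
    by congr rsum; apply/funext => w; rewrite (raddf_sum (@complex.Re R)).
  apply: (rsummable_le _ sh) => x.
  by rewrite ger0_norm ?sumr_ge0//; apply: ler_sum => w _; exact: ler_Re_normc.
transitivity (rsum (fun x => \sum_(w <- L x) complex.Im (h x w))).
  by congr rsum; apply/funext => x; rewrite (raddf_sum (@complex.Im R)).
rewrite rsum_exchange.
  by congr rsum; apply/funext => w; rewrite (raddf_sum (@complex.Im R)).
apply: (rsummable_le _ sh) => x.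
by rewrite ger0_norm ?sumr_ge0//; apply: ler_sum => w _; exact: ler_Im_normc.
Qed.

Lemma csummable_exchange (h : X -> W -> R[i]) :
  rsummable (fun x => \sum_(w <- L x) normc (h x w)) ->
  csummable (fun w => \sum_(x <- M w) h x w).
Proof.
move=> sh.
have : rsummable (fun w => \sum_(x <- M w) normc (h x w)).
  have n0 (x : X) w : 0 <= normc (h x w) by exact: normc_ge0.
  move: sh; rewrite !rsummable_ge0E ?esum_exchange// => x; exact: sumr_ge0.
apply: rsummable_le => w; rewrite ger0_norm ?normc_ge0//.
exact: normc_sum_le.
Qed.

End Exchange.

Section FiniteSums.
Context {R : realType} {X : choiceType}.

Lemma csummable_sum (I : Type) (s : seq I) (f : I -> X -> R[i]) :
  (forall i, csummable (f i)) -> csummable (fun x => \sum_(i <- s) f i x).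
Proof.
move=> sf; elim: s => [|i s IH].
  rewrite /csummable /rsummable /summable esum1// => x _.
  by rewrite big_nil normc0 /= normr0.
apply: (rsummable_le _ (rsummableD (sf i) IH)) => x.
by rewrite ger0_norm ?normc_ge0// big_cons; exact: le_normcD.
Qed.

Lemma csum_sum (I : Type) (s : seq I) (f : I -> X -> R[i]) :
  (forall i, csummable (f i)) ->
  csum (fun x => \sum_(i <- s) f i x) = \sum_(i <- s) csum (f i).
Proof.
move=> sf; elim: s => [|i s IH].
  rewrite big_nil; under eq_fun do rewrite big_nil.
  have s0 : csummable (fun _ : X => 0 : R[i]).
    by have := csummable_sum [::] sf; under eq_fun do rewrite big_nil.
  by have := csumZ 0 s0; rewrite !mul0r.
rewrite big_cons -IH -csumD//; last exact: csummable_sum.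
by congr csum; apply/funext => x; rewrite big_cons.
Qed.

Lemma rsum_ge0 (g : X -> R) : (forall x, 0 <= g x) -> rsum g = nnsum g.
Proof.
move=> g0; rewrite /rsum [X in _ - X](_ : _ = 0).
  by rewrite subr0; apply: eq_nnsum => x; rewrite max_l.
by rewrite /nnsum esum1//= => x _; rewrite max_r// oppr_le0.
Qed.

Lemma csum_ge0 (f : X -> R[i]) : (forall x, 0 <= f x) -> 0 <= csum f.
Proof.
move=> f0; rewrite lecE /csum /=; apply/andP; split.
  rewrite rsum_ge0 => [|x]; last by rewrite ger0_Im.
  by rewrite /nnsum esum1//= => x _; rewrite ger0_Im.
have fr x : 0 <= complex.Re (f x) by have := f0 x; rewrite lecE => /andP[].
by rewrite rsum_ge0//; exact: nnsum_ge0.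
Qed.

End FiniteSums.

(** * Square-summable families *)

Section Ell2Facts.
Context {R : realType} {X : choiceType}.
Implicit Types (f g : ell2 R X) (x y : X) (A : {fset X}) (r : R).
Local Notation ell2 := (ell2 R X).
Local Notation norm2 := (hnorm (@l2dot R X)).

Lemma ell2DE f g x : (f + g) x = f x + g x. Proof. by []. Qed.

Lemma ell2BE f g x : (f - g) x = f x - g x. Proof. by []. Qed.

Lemma ell2ZE (c : R[i]) f x : (c *: f) x = c * f x. Proof. by []. Qed.

Lemma ell2_sumE (I : Type) (s : seq I) (F : I -> ell2) x :
  (\sum_(i <- s) F i) x = \sum_(i <- s) F i x.
Proof.
by elim: s => [|i s IH]; rewrite ?big_nil// !big_cons ell2DE IH.
Qed.

Lemma esum_hnorm f :
  (\esum_(x in [set: X]) (normc (f x) ^+ 2)%:E = (norm2 f ^+ 2)%:E)%E.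
Proof.
rewrite nnsum_fin; last exact: sqsummableP; last by move=> x; exact: sqr_ge0.
by congr EFin; apply: (@complexI R); rewrite -dot_self; exact/esym/l2dotE.
Qed.

Lemma hnorm_le f r : 0 <= r ->
  (\esum_(x in [set: X]) (normc (f x) ^+ 2)%:E <= (r ^+ 2)%:E)%E -> norm2 f <= r.
Proof.
by move=> r0; rewrite esum_hnorm lee_fin ler_pXn2r// nnegrE hnorm_ge0.
Qed.

Lemma sum_fset_le_hnorm f A : \sum_(x <- A) normc (f x) ^+ 2 <= norm2 f ^+ 2.
Proof.
rewrite -lee_fin -esum_hnorm; apply: esum_ge; exists [set` A] => //.
by rewrite fsbig_finite//= set_fsetK sumEFin.
Qed.

Lemma normc_le_hnorm f x : normc (f x) <= norm2 f.
Proof.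
rewrite -(@ler_pXn2r _ 2)// ?nnegrE ?hnorm_ge0 ?normc_ge0//.
by have := sum_fset_le_hnorm f [fset x]%fset; rewrite big_seq_fset1.
Qed.

Lemma normc_l2dot_delta_le f x : normc (l2dot f (delta x)) <= norm2 f.
Proof. by rewrite l2dot_delta normc_le_hnorm. Qed.

Lemma deltaE x y : delta (R := R) x y = (y == x)%:R. Proof. by []. Qed.

Lemma hnorm_delta x : norm2 (delta x) = 1.
Proof.
have e : l2dot (delta x) (delta x) = 1 :> R[i] by rewrite l2dot_delta deltaE eqxx.
by rewrite /hnorm [X in complex.Re X]e sqrtr1.
Qed.

Lemma delta_sumE f A x :
  (\sum_(y <- A) f y *: delta y) x = if x \in A then f x else 0.
Proof.
rewrite ell2_sumE; have [xA|xA] := boolP (x \in A).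
  rewrite (bigD1_seq x) ?fset_uniq// ell2ZE deltaE eqxx mulr1 big1.
    exact: addr0.
  by move=> y /negbTE yx; rewrite ell2ZE deltaE eq_sym yx mulr0.
rewrite big_seq big1// => y yA; rewrite ell2ZE deltaE.
by case: eqP yA xA => [<- ->//|]; rewrite mulr0.
Qed.

(** A bounded operator is only known through its values on the basis vectors; this
density is what determines it from its matrix. *)
Lemma delta_dense f r : 0 < r ->
  exists A, forall B : {fset X}, {subset A <= B} ->
    norm2 (f - \sum_(y <- B) f y *: delta y) <= r.
Proof.
move=> r0; have fin : (\esum_(x in [set: X]) (normc (f x) ^+ 2)%:E)%E \is a fin_num.
  by rewrite esum_hnorm.
have [_ [A [finA _] <-]] := ub_ereal_sup_adherent (exprn_gt0 2 r0) fin.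
rewrite -/(esum _ _) => lt_A; exists (fset_set A) => B AB.
apply: hnorm_le; first exact: ltW.
pose rest := (\esum_(x in ~` A) (normc (f x) ^+ 2)%:E)%E.
have split_norm : (norm2 f ^+ 2)%:E =
    (\sum_(x \in A) (normc (f x) ^+ 2)%:E + rest)%E.
  rewrite -esum_hnorm (esumID A); last by move=> *; rewrite lee_fin sqr_ge0.
  by rewrite !setTI esum_fset// => *; rewrite lee_fin sqr_ge0.
apply: (@le_trans _ _ rest).
  rewrite /rest [leRHS]esum_mkcond; apply: le_esum => x _.
  rewrite ell2BE delta_sumE; have [xB|xB] := boolP (x \in B).
    by rewrite subrr normc0 expr0n/=; case: ifP => // _; rewrite lee_fin sqr_ge0.
  rewrite subr0 ifT// in_setC; apply: contra xB => xA; apply: AB.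
  by rewrite in_fset_set.
move: lt_A; rewrite esum_hnorm split_norm fsbig_finite//= sumEFin.
case: rest split_norm => [s||] _ //; last by rewrite leNye.
by rewrite -!EFinD lte_fin lee_fin; lra.
Qed.

(** The row of [x] has finite support, so that the expansion of [a f x] is a finite
sum. Both sides are continuous in [f] and agree on finitely supported vectors. *)
Lemma row_expansion (a : ell2 -> ell2) x A f :
  bounded_operators l2dot a ->
  (forall y, y \notin A -> l2dot (a (delta y)) (delta x) = 0) ->
  a f x = \sum_(y <- A) l2dot (a (delta y)) (delta x) * f y.
Proof.
move=> [la afin] aA; have [r _ [r0 ar]] := bounded_opP la afin.
have a_sum (B : {fset X}) : a (\sum_(y <- B) f y *: delta y) x =
    \sum_(y <- B) l2dot (a (delta y)) (delta x) * f y.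
  rewrite (linear_sumZ _ _ _ la) ell2_sumE; apply: eq_bigr => y _.
  by rewrite ell2ZE l2dot_delta mulrC.
apply/eqP; rewrite -subr_eq0; apply/eqP/eq0_normc.
apply/eqP; rewrite eq_le normc_ge0 andbT; apply/ler_addgt0Pr => e e0.
rewrite add0r; have r1 : 0 < e / (r + 1) by rewrite divr_gt0// ltr_wpDl.
have [B normB] := delta_dense f r1.
have {normB} := normB (A `|` B)%fset; set g := f - _ => normg.
have -> : \sum_(y <- A) l2dot (a (delta y)) (delta x) * f y =
    a (\sum_(y <- (A `|` B)%fset) f y *: delta y) x.
  rewrite a_sum; apply: big_fset_incl => [|y _ yA]; first exact: fsubsetUl.
  by rewrite aA// mul0r.
have -> : a f x - a (\sum_(y <- (A `|` B)%fset) f y *: delta y) x = a g x.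
  by rewrite /g (linear_subE _ _ la) ell2BE.
apply: (le_trans (normc_le_hnorm _ _)); apply: (le_trans (ar g)).
have {}normg : norm2 g <= e / (r + 1).
  by apply: normg => y yB; rewrite in_fsetU yB orbT.
apply: (@le_trans _ _ ((r + 1) * (e / (r + 1)))).
  by apply: ler_pM => //; rewrite ?hnorm_ge0// lerDl.
by rewrite mulrC divfK// gt_eqF// ltr_wpDl.
Qed.

End Ell2Facts.

(** * From matrices to band operators *)

Section Cv.
Context {R : realType} (k : nat).
Implicit Types (u v : 'cV[R[i]]_k).
Local Notation norm2 := (hnorm (@cvdot R k)).

Lemma cvdotE u v : cvdot k u v = \sum_p u p 0 * (v p 0)^*.
Proof.
rewrite /cvdot dotmxE mxE; apply: eq_bigr => p _; by rewrite !mxE.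
Qed.

Lemma mulc_conj (z : R[i]) : z * z^* = (normc z ^+ 2)%:C.
Proof.
rewrite sqr_normcE; case: z => a b; apply/eqP; rewrite eq_complex /=.
by apply/andP; split; apply/eqP; ring.
Qed.

Lemma cv_hnorm u : norm2 u ^+ 2 = \sum_p normc (u p 0) ^+ 2.
Proof.
apply: (@complexI R); rewrite -dot_self.
rewrite (rmorph_sum (real_complex R)) -[LHS]/(cvdot k u u) cvdotE.
by apply: eq_bigr => p _; rewrite mulc_conj.
Qed.

Lemma matrix_algebra_linear (g : 'cV[R[i]]_k -> 'cV[R[i]]_k) :
  matrix_algebra R k g -> linear g.
Proof. by move=> [A _ <-] c u v; rewrite linearP. Qed.

(** The Hilbert-Schmidt norm, up to the factor [sqrt k] lost by using
[sqr_sum_le], bounds the operator norm. *)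
Lemma matrix_algebra_bounded (g : 'cV[R[i]]_k -> 'cV[R[i]]_k) :
  matrix_algebra R k g -> exists2 r, 0 <= r & forall u, norm2 (g u) <= r * norm2 u.
Proof.
move=> [A _ <-].
pose S := \sum_i k%:R * \sum_j normc (A i j) ^+ 2.
have S0 : 0 <= S.
  by apply: sumr_ge0 => i _; rewrite mulr_ge0// sumr_ge0// => j _; exact: sqr_ge0.
exists (Num.sqrt S) => [|u]; first exact: sqrtr_ge0.
rewrite -(@ler_pXn2r _ 2)// ?nnegrE ?mulr_ge0 ?hnorm_ge0 ?sqrtr_ge0//.
rewrite [leLHS]cv_hnorm [leRHS]exprMn (sqr_sqrtr S0) mulr_suml; apply: ler_sum => i _.
rewrite mxE -mulrA mulr_suml.
apply: (@le_trans _ _ ((\sum_j normc (A i j * u j 0)) ^+ 2)).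
  by rewrite ler_pXn2r// ?nnegrE ?sumr_ge0 ?normc_ge0 ?normc_sum_le// => *; exact: normc_ge0.
apply: (le_trans (sqr_sum_le _ _)).
have -> : size (index_enum 'I_k) = k by rewrite -[RHS]card_ord cardT enumT.
rewrite ler_wpM2l//; apply: ler_sum => j _; rewrite normcM exprMn.
rewrite ler_wpM2l ?sqr_ge0// cv_hnorm (bigD1 j)//= lerDl sumr_ge0// => *.
exact: sqr_ge0.
Qed.

End Cv.

Lemma conjc_realM (R : realType) (r : R) (z : R[i]) :
  (r%:C * z)^* = r%:C * z^*.
Proof. by case: z => a b; apply/eqP; rewrite eq_complex /=; apply/andP; split; apply/eqP; ring. Qed.

Section Spreading.
Context {R : realType} {X W : choiceType}.
Variables (L : X -> {fset W}) (M : W -> {fset X}).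
Hypothesis LM : forall x w, (w \in L x) = (x \in M w).
Hypothesis L_neq0 : forall x, L x != fset0.

(** The normalization for which the weights, counted once for each label of [x],
have squares of sum 1. *)
Definition weight (x : X) : R := (Num.sqrt #|` L x|%:R)^-1.

Lemma weight_ge0 x : 0 <= weight x.
Proof. by rewrite invr_ge0 sqrtr_ge0. Qed.

Lemma sqr_weight x : weight x ^+ 2 * #|` L x|%:R = 1.
Proof.
rewrite /weight exprVn sqr_sqrtr// mulVf// pnatr_eq0 -lt0n.
by rewrite cardfs_gt0.
Qed.

(** Cauchy-Schwarz over the labels of [x]: the factor [#(L x)] that it costs is
cancelled by the weight. *)
Lemma averaging_le (U : X -> W -> R) :
  (\esum_(x in [set: X]) ((weight x * \sum_(w <- L x) U x w) ^+ 2)%:E <=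
   \esum_(w in [set: W]) (\sum_(x <- M w) U x w ^+ 2)%:E)%E.
Proof.
rewrite -(esum_exchange LM) => [|x w]; last exact: sqr_ge0.
apply: le_esum => x _; rewrite lee_fin exprMn.
apply: (le_trans (ler_wpM2l (sqr_ge0 _) (sqr_sum_le _ _))).
by rewrite mulrA sqr_weight mul1r.
Qed.

(** The maps [gather w] together form an isometry. *)
Lemma esum_weight (f : ell2 R X) :
  (\esum_(w in [set: W]) (\sum_(x <- M w) (weight x * normc (f x)) ^+ 2)%:E =
   (hnorm l2dot f ^+ 2)%:E)%E.
Proof.
rewrite -(esum_exchange LM) => [|x w]; last exact: sqr_ge0.
rewrite -esum_hnorm; apply: eq_esum => x _; congr EFin.
rewrite big_const_seq count_predT iter_addr_0 exprMn -mulr_natr.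
by rewrite mulrAC sqr_weight mul1r.
Qed.

Variables (k : nat) (slot : W -> X -> 'I_k).
Hypothesis slot_inj : forall w, {in M w &, injective (slot w)}.
Implicit Types (f : ell2 R X) (g : 'cV[R[i]]_k -> 'cV[R[i]]_k).

(** The operator [V_w]: the coordinate [slot w x] of C^k
stands for the point [x] of [M w]. *)
Definition gather w (f : ell2 R X) : 'cV[R[i]]_k :=
  \col_p \sum_(x <- M w) (p == slot w x)%:R * ((weight x)%:C * f x).

(** The operator [sum_w V_w^* g V_w]. It is a finite sum at each point. *)
Definition spread_fun g (f : ell2 R X) x : R[i] :=
  (weight x)%:C * \sum_(w <- L x) g (gather w f) (slot w x) 0.

(** The default value 0 is used only when [spread_fun g f] is not square summable,
which does not occur for [g] in the matrix algebra. *)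
Definition spread g f : ell2 R X := insubd 0 (spread_fun g f).

Lemma gatherP w (c : R[i]) (f h : ell2 R X) :
  gather w (c *: f + h) = c *: gather w f + gather w h.
Proof.
apply/matrixP => p j; rewrite !mxE mulr_sumr -big_split /=.
apply: eq_bigr => x _.
by rewrite -[X in _ * (_ * X) = _]/(c * f x + h x); ring.
Qed.

Lemma gather_slot w f x : x \in M w -> gather w f (slot w x) 0 = (weight x)%:C * f x.
Proof.
move=> xM; rewrite mxE (bigD1_seq x) ?fset_uniq//= eqxx mul1r big1_seq ?addr0//.
move=> y /andP[yx yM]; case: eqP => [/(slot_inj xM yM) xy|]; last by rewrite mul0r.
by rewrite xy eqxx in yx.
Qed.

Lemma cvdot_gather w f (u : 'cV[R[i]]_k) : cvdot k u (gather w f) =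
  \sum_(x <- M w) u (slot w x) 0 * ((weight x)%:C * f x)^*.
Proof.
rewrite cvdotE; under eq_bigr do rewrite mxE rmorph_sum mulr_sumr.
rewrite exchange_big /=; apply: eq_bigr => x _.
rewrite (bigD1 (slot w x))//= eqxx mul1r big1 ?addr0// => p /negbTE ->.
by rewrite mul0r rmorph0 mulr0.
Qed.

Lemma hnorm_gather w f : hnorm (cvdot k) (gather w f) ^+ 2 =
  \sum_(x <- M w) (weight x * normc (f x)) ^+ 2.
Proof.
apply: (@complexI R); rewrite -dot_self -[LHS]/(cvdot k _ _) cvdot_gather.
rewrite (rmorph_sum (real_complex R)) !big_seq; apply: eq_bigr => x xM.
by rewrite gather_slot// mulc_conj normcM normc_real ger0_norm ?weight_ge0.
Qed.

Lemma sum_slot_le w (u : 'cV[R[i]]_k) :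
  \sum_(x <- M w) normc (u (slot w x) 0) ^+ 2 <= hnorm (cvdot k) u ^+ 2.
Proof.
rewrite cv_hnorm -(big_map (slot w) xpredT (fun p => normc (u p 0) ^+ 2)).
rewrite big_uniq /=; last by rewrite map_inj_in_uniq ?fset_uniq//; exact: slot_inj.
by rewrite big_mkcond; apply: ler_sum => p _; case: ifP => // _; exact: sqr_ge0.
Qed.


Local Notation V := gather.
Local Notation wt := weight.
Local Notation norm2 := (hnorm (@l2dot R X)).
Local Notation normk := (hnorm (@cvdot R k)).

Lemma esum_gather_le g r f : 0 <= r -> (forall u, normk (g u) <= r * normk u) ->
  (\esum_(w in [set: W]) (normk (g (V w f)) ^+ 2)%:E <= ((r * norm2 f) ^+ 2)%:E)%E.
Proof.
move=> r0 gr.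
apply: (@le_trans _ _ (\esum_(w in [set: W]) (r ^+ 2 * normk (V w f) ^+ 2)%:E)%E).
  apply: le_esum => w _; rewrite lee_fin -exprMn.
  by rewrite ler_pXn2r// nnegrE ?mulr_ge0 ?hnorm_ge0.
rewrite esumZ ?sqr_ge0//; last by move=> w; exact: sqr_ge0.
under eq_esum do rewrite hnorm_gather.
by rewrite esum_weight -EFinM exprMn.
Qed.

Lemma spread_fun_le g r f : 0 <= r -> (forall u, normk (g u) <= r * normk u) ->
  (\esum_(x in [set: X]) (normc (spread_fun g f x) ^+ 2)%:E <=
   ((r * norm2 f) ^+ 2)%:E)%E.
Proof.
move=> r0 gr; apply: le_trans (esum_gather_le f r0 gr).
pose U x w := normc (g (V w f) (slot w x) 0).
apply: (@le_trans _ _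
    (\esum_(x in [set: X]) ((wt x * \sum_(w <- L x) U x w) ^+ 2)%:E)%E).
  apply: le_esum => x _; rewrite lee_fin ler_pXn2r// ?nnegrE ?normc_ge0//.
    rewrite normcM normc_real ger0_norm ?weight_ge0//.
    by rewrite ler_wpM2l ?weight_ge0 ?normc_sum_le.
  by rewrite mulr_ge0 ?weight_ge0 ?sumr_ge0// => w _; exact: normc_ge0.
apply: (le_trans (averaging_le U)).
by apply: le_esum => w _; rewrite lee_fin; exact: sum_slot_le.
Qed.

Lemma spreadE g f x : matrix_algebra R k g -> spread g f x = spread_fun g f x.
Proof.
move=> /matrix_algebra_bounded[r r0 gr].
have sf : spread_fun g f \in @sqsummable R X.
  apply/asboolP; rewrite rsummable_ge0E => [|y]; last exact: sqr_ge0.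
  exact: le_lt_trans (spread_fun_le f r0 gr) (ltry _).
by rewrite /spread insubdK.
Qed.

Lemma hnorm_spread_le g r f : matrix_algebra R k g -> 0 <= r ->
  (forall u, normk (g u) <= r * normk u) -> norm2 (spread g f) <= r * norm2 f.
Proof.
move=> gM r0 gr; apply: hnorm_le; first by rewrite mulr_ge0 ?hnorm_ge0.
by under eq_esum do rewrite spreadE//; exact: spread_fun_le.
Qed.

Lemma spread_linear g : matrix_algebra R k g -> linear (spread g).
Proof.
move=> gM c f h; apply/val_inj/funext => x.
rewrite -[RHS]/(c * spread g f x + spread g h x) [LHS]spreadE// !spreadE//.
rewrite /spread_fun mulrCA -mulrDr; congr (_ * _).
rewrite mulr_sumr -big_split; apply: eq_bigr => w _.
by rewrite gatherP (matrix_algebra_linear gM) !mxE.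
Qed.

Lemma opnorm_spread_le g : matrix_algebra R k g ->
  (opnorm l2dot (spread g) <= opnorm (cvdot k) g)%E.
Proof.
move=> gM; have gl := matrix_algebra_linear gM.
have [r r0 gr] := matrix_algebra_bounded gM.
have gfin : (opnorm (cvdot k) g < +oo)%E by apply: le_lt_trans (opnorm_le r0 gr) (ltry _).
have [s -> [s0 gs]] := bounded_opP gl gfin.
by apply: opnorm_le => // f; exact: hnorm_spread_le.
Qed.

Lemma spread_bounded g : matrix_algebra R k g ->
  bounded_operators l2dot (spread g).
Proof.
move=> gM; split; first exact: spread_linear.
have [r r0 gr] := matrix_algebra_bounded gM.
apply: le_lt_trans (opnorm_spread_le gM) _.
exact: le_lt_trans (opnorm_le r0 gr) (ltry _).
Qed.

Lemma spread_band g : matrix_algebra R k g ->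
  band_operators R [set p | exists w, w \in L p.1 /\ w \in L p.2] (spread g).
Proof.
move=> gM; split=> [|x y nxy]; first exact: spread_bounded.
rewrite l2dot_delta spreadE// /spread_fun big_seq big1 ?mulr0// => w wx.
have -> : V w (delta (R := R) y) = 0.
  apply/matrixP => p j; rewrite !mxE big_seq big1// => z zM.
  rewrite deltaE; have [zy|_] := eqVneq z y; last by rewrite mulr0n !mulr0.
  by case: nxy; exists w; split=> //=; rewrite LM -zy.
case: gM => A _ <-; by rewrite mulmx0 mxE.
Qed.

(** The quadratic form of [spread g] is the sum over the labels of the compressed
forms of [g]. Since each label contributes a form of the same shape, positivity
of matrices over the algebra passes through [spread]. *)
Lemma spread_dot g f h : matrix_algebra R k g ->
  csummable (fun w => cvdot k (g (V w f)) (V w h)) /\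
  l2dot (spread g f) h = csum (fun w => cvdot k (g (V w f)) (V w h)).
Proof.
move=> gM; have [r r0 gr] := matrix_algebra_bounded gM.
pose H x w := g (V w f) (slot w x) 0 * ((wt x)%:C * h x)^*.
have sH : rsummable (fun x => \sum_(w <- L x) normc (H x w)).
  rewrite rsummable_ge0E; last by move=> x; rewrite sumr_ge0// => w _; exact: normc_ge0.
  rewrite (esum_exchange LM) => [|x w]; last exact: normc_ge0.
  have Hle w : \sum_(x <- M w) normc (H x w) <=
      normk (g (V w f)) ^+ 2 + \sum_(x <- M w) (wt x * normc (h x)) ^+ 2.
    apply: le_trans _ (lerD (sum_slot_le w _) (lexx _)).
    rewrite -big_split /=; apply: ler_sum => x _.
    rewrite /H normcM normc_conj normcM normc_real ger0_norm ?weight_ge0//.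
    set p := normc _; set q := wt x * _.
    by have := sqr_ge0 (p - q); have := sqr_ge0 (p + q); nra.
  apply: (@le_lt_trans _ _ (((r * norm2 f) ^+ 2)%:E + (norm2 h ^+ 2)%:E)%E).
    rewrite -esum_weight; apply: le_trans _ (leeD (esum_gather_le f r0 gr) (lexx _)).
    rewrite -esumD.
    - by apply: le_esum => w _; rewrite -EFinD lee_fin.
    - by move=> w _; rewrite lee_fin sqr_ge0.
    - by move=> w _; rewrite lee_fin sumr_ge0// => x _; exact: sqr_ge0.
  by rewrite -EFinD ltry.
have HE w : cvdot k (g (V w f)) (V w h) = \sum_(x <- M w) H x w.
  by rewrite cvdot_gather.
under eq_fun do rewrite HE; split; first exact: csummable_exchange sH.
rewrite /l2dot (_ : (fun x => _) = fun x => \sum_(w <- L x) H x w); last first.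
  apply/funext => x; rewrite spreadE// /spread_fun -mulrA mulrCA mulr_suml.
  by apply: eq_bigr => w _; congr (_ * _); exact/esym/conjc_realM.
exact: csum_exchange.
Qed.

Lemma spread_positive n (g : 'M['cV[R[i]]_k -> 'cV[R[i]]_k]_n) :
  (forall i j, matrix_algebra R k (g i j)) ->
  positive_mx (cvdot k) g -> positive_mx l2dot (map_mx spread g).
Proof.
move=> gM gpos f.
have -> : \sum_i \sum_j l2dot (map_mx spread g i j (f j)) (f i) =
    csum (fun w => \sum_i \sum_j cvdot k (g i j (V w (f j))) (V w (f i))).
  rewrite csum_sum => [|i].
    apply: eq_bigr => i _; rewrite csum_sum => [|j].
      by apply: eq_bigr => j _; rewrite mxE; exact: (spread_dot _ _ (gM i j)).2.
    exact: (spread_dot _ _ (gM i j)).1.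
  apply: csummable_sum => j; exact: (spread_dot _ _ (gM i j)).1.
by apply: csum_ge0 => w; exact: (gpos (fun j => V w (f j))).
Qed.

End Spreading.

(** * From operators to matrices *)

Section Compression.
Context {R : realType} {X : choiceType} {K : finType} {N : nat}.
Variable (rs : K -> {fset X}).
Hypothesis rs_size : forall t, (#|` rs t| <= N.+1)%N.
Implicit Types (f : ell2 R X) (a b : ell2 R X -> ell2 R X).
Local Notation k := #|{: K * 'I_N.+1}|.
Local Notation norm2 := (hnorm (@l2dot R X)).
Local Notation normk := (hnorm (@cvdot R k)).

(** The coordinates of C^k are indexed by a block [t] and a position [i] in it. *)
Definition cell (p : 'I_k) : K * 'I_N.+1 := enum_val p.

(** The basis vector of the [i]-th point of [A]; the default value 0 pads the
blocks to a common size. *)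
Definition site (A : {fset X}) (i : nat) : ell2 R X := nth 0 [seq delta x | x <- A] i.

Definition synthesis (v : 'cV[R[i]]_k) (t : K) : ell2 R X :=
  \sum_(i < N.+1) v (enum_rank (t, i)) 0 *: site (rs t) i.

(** Block diagonal: the block [t] of the result is the compression of [a] to the
span of the points of [rs t]. *)
Definition compress a (v : 'cV[R[i]]_k) : 'cV[R[i]]_k :=
  \col_p l2dot (a (synthesis v (cell p).1))
               (site (rs (cell p).1) (cell p).2).

Lemma sum_enum_val (T : zmodType) (F : K -> 'I_N.+1 -> T) :
  \sum_(p < k) F (cell p).1 (cell p).2 = \sum_t \sum_i F t i.
Proof.
rewrite (reindex (@enum_rank _)) /=; last exact/onW_bij/enum_rank_bij.
by under eq_bigr do rewrite /cell enum_rankK; rewrite pair_bigA.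
Qed.

Lemma normk_blocks (v : 'cV[R[i]]_k) :
  normk v ^+ 2 = \sum_t \sum_i normc (v (enum_rank (t, i)) 0) ^+ 2.
Proof.
rewrite cv_hnorm -(sum_enum_val (fun t i => normc (v (enum_rank (t, i)) 0) ^+ 2)).
by apply: eq_bigr => p _; rewrite -surjective_pairing /cell enum_valK.
Qed.

Lemma site_index (A : {fset X}) x : x \in A -> site A (index x A) = delta x.
Proof.
by move=> xA; rewrite /site (nth_map x) ?index_mem// nth_index.
Qed.

Lemma bessel f (A : {fset X}) : (#|` A| <= N.+1)%N ->
  \sum_(i < N.+1) normc (l2dot f (site A i)) ^+ 2 <= norm2 f ^+ 2.
Proof.
move=> AN; apply: le_trans (sum_fset_le_hnorm f A).
pose F g := normc (l2dot f g) ^+ 2.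
have -> : \sum_(i < N.+1) normc (l2dot f (site A i)) ^+ 2 =
    \sum_(g <- [seq delta x | x <- A]) F g.
  rewrite [RHS](big_nth 0) size_map.
  rewrite -(big_mkord xpredT (fun i => F (site A i))).
  rewrite (big_cat_nat _ (n := #|` A|))//= [X in _ + X]big_nat [X in _ + X]big1 ?addr0//.
  move=> i /andP[Ai _]; rewrite /F /site nth_default ?size_map//.
  by rewrite linear0r normc0 expr0n.
by rewrite big_map; apply: ler_sum => x _; rewrite /F l2dot_delta.
Qed.

Lemma l2dot_sumr f (I : Type) (s : seq I) (c : I -> R[i]) (F : I -> ell2 R X) :
  l2dot f (\sum_(i <- s) c i *: F i) = \sum_(i <- s) (c i)^* * l2dot f (F i).
Proof.
rewrite linear_sumr; apply: eq_bigr => i _; exact: linearZr_LR.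
Qed.

Lemma l2dot_suml f (I : Type) (s : seq I) (c : I -> R[i]) (F : I -> ell2 R X) :
  l2dot (\sum_(i <- s) c i *: F i) f = \sum_(i <- s) c i * l2dot (F i) f.
Proof.
rewrite linear_sumlz; apply: eq_bigr => i _; exact: linearZl_LR.
Qed.

(** [synthesis] is adjoint to taking coefficients, so Bessel's inequality
for the coefficients implies this one: with [u] the synthesis and [b_i] its
coefficients, [|u|^2 = Re sum_i (v_i)^* b_i <= |v|^2 / 2 + |u|^2 / 2]. *)
Lemma synthesis_le v t : norm2 (synthesis v t) ^+ 2 <=
  \sum_i normc (v (enum_rank (t, i)) 0) ^+ 2.
Proof.
have half_sqr (p q : R) : p * q <= p ^+ 2 / 2 + q ^+ 2 / 2.
  by have := sqr_ge0 (p - q); nra.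
have half (p q : R) : p <= q / 2 + p / 2 -> p <= q by lra.
apply: half; set u := synthesis v t; set S := \sum_i _.
apply: (@le_trans _ _ (S / 2 + (\sum_(i < N.+1) normc (l2dot u (site (rs t) i)) ^+ 2) / 2)).
  have -> : norm2 u ^+ 2 = complex.Re (l2dot u u) by rewrite [l2dot u u]dot_self.
  rewrite {2}/u l2dot_sumr (le_trans (ler_norm _))// (le_trans (ler_Re_normc _))//.
  apply: (le_trans (normc_sum_le _ _)).
  rewrite /S !mulr_suml -big_split; apply: ler_sum => i _ /=.
  rewrite normcM normc_conj; exact: half_sqr.
by rewrite lerD2l ler_pM2r ?invr_gt0//; exact: bessel.
Qed.

Lemma hnorm_compress_le a r v : 0 <= r -> (forall f, norm2 (a f) <= r * norm2 f) ->
  normk (compress a v) <= r * normk v.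
Proof.
move=> r0 ar; rewrite -(@ler_pXn2r _ 2)// ?nnegrE ?mulr_ge0 ?hnorm_ge0//.
rewrite [leLHS]cv_hnorm [leRHS]exprMn; under eq_bigr do rewrite mxE.
rewrite (sum_enum_val (fun t i => normc (l2dot (a (synthesis v t)) (site (rs t) i)) ^+ 2)).
rewrite normk_blocks mulr_sumr; apply: ler_sum => t _.
apply: (le_trans (bessel _ (rs_size t))).
apply: (@le_trans _ _ (r ^+ 2 * norm2 (synthesis v t) ^+ 2)).
  by rewrite -exprMn ler_pXn2r// nnegrE ?mulr_ge0 ?hnorm_ge0.
by rewrite ler_wpM2l ?sqr_ge0//; exact: synthesis_le.
Qed.

Lemma synthesisP t (c : R[i]) v v' :
  synthesis (c *: v + v') t = c *: synthesis v t + synthesis v' t.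
Proof.
rewrite /synthesis scaler_sumr -big_split; apply: eq_bigr => i _.
by rewrite /= !mxE scalerDl scalerA.
Qed.

Lemma compress_matrix a : linear a -> matrix_algebra R k (compress a).
Proof.
move=> al; apply: mx_linearE => c v v'; apply/matrixP => p j; rewrite !mxE.
by rewrite synthesisP al l2dot_linearl.
Qed.

Lemma compressP (c : R[i]) a b : compress (c *: a + b) = c *: compress a + compress b.
Proof.
apply/funext => v; apply/matrixP => p j.
by rewrite -[RHS]/((c *: compress a v + compress b v) p j) !mxE -l2dot_linearl.
Qed.

Lemma opnorm_compress_le a : linear a ->
  (opnorm (cvdot k) (compress a) <= opnorm l2dot a)%E.
Proof.
move=> al; have [afin|] := ltP (opnorm l2dot a) +oo%E; last first.
  by rewrite leye_eq => /eqP ->; rewrite leey.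
have [s -> [s0 as_]] := bounded_opP al afin.
by apply: opnorm_le => // v; exact: hnorm_compress_le.
Qed.

Lemma compress_positive n (a : 'M[ell2 R X -> ell2 R X]_n) :
  positive_mx l2dot a -> positive_mx (cvdot k) (map_mx compress a).
Proof.
move=> apos v.
have -> : \sum_i \sum_j cvdot k (map_mx compress a i j (v j)) (v i) =
    \sum_t \sum_i \sum_j l2dot (a i j (synthesis (v j) t)) (synthesis (v i) t).
  rewrite [RHS]exchange_big; apply: eq_bigr => i _.
  rewrite [RHS]exchange_big; apply: eq_bigr => j _.
  rewrite mxE cvdotE.
  under [RHS]eq_bigr do rewrite [synthesis (v i) _]/synthesis l2dot_sumr.
  rewrite -(sum_enum_val (fun t s => (v i (enum_rank (t, s)) 0)^* *
    l2dot (a i j (synthesis (v j) t)) (site (rs t) s))).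
  apply: eq_bigr => p _.
  by rewrite mxE -surjective_pairing /cell enum_valK mulrC.
by apply: sumr_ge0 => t _; exact: (apos (fun j => synthesis (v j) t)).
Qed.

End Compression.

Lemma hnorm_site_le (R : realType) (X : choiceType) (A : {fset X}) i :
  hnorm l2dot (site (R := R) A i) <= 1.
Proof.
rewrite /site; have [iA|Ai] := ltnP i (size (enum_fset A)).
  case: (enum_fset A) iA => // x0 A' iA.
  by rewrite (nth_map x0)// hnorm_delta.
by rewrite nth_default ?size_map// hnorm0.
Qed.

Lemma l2dot_site_le (R : realType) (X : choiceType) (f : ell2 R X) (A : {fset X}) i :
  normc (l2dot f (site A i)) <= hnorm l2dot f.
Proof.
rewrite /site; have [iA|Ai] := ltnP i (size (enum_fset A)).
  case: (enum_fset A) iA => // x0 A' iA.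
  by rewrite (nth_map x0)// normc_l2dot_delta_le.
by rewrite nth_default ?size_map// linear0r normc0 hnorm_ge0.
Qed.

(** * The composite is close to the identity on band operators *)

Section Approximation.
Context {R : realType} {X W : choiceType} {K : finType} {N : nat}.
Variables (L : X -> {fset W}) (M : W -> {fset X}).
Hypothesis LM : forall x w, (w \in L x) = (x \in M w).
Hypothesis L_neq0 : forall x, L x != fset0.
Hypothesis M_size : forall w, (#|` M w| <= N.+1)%N.
Variables (kappa : W -> K) (rs : K -> {fset X}).
Implicit Types (f : ell2 R X) (b : ell2 R X -> ell2 R X).
Local Notation k := #|{: K * 'I_N.+1}|.
Local Notation norm2 := (hnorm (@l2dot R X)).
Local Notation wt := (weight (R := R) L).

(** A point of [M w] takes its position in the list [M w], in the block of the class
of [w]. *)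
Definition slot_of (w : W) (x : X) : 'I_k :=
  enum_rank (kappa w, inord (index x (M w)) : 'I_N.+1).

Lemma slot_of_inj w : {in M w &, injective (slot_of w)}.
Proof.
move=> x y xM yM /enum_rank_inj[] /(congr1 val) /=.
have idx z : z \in M w -> (index z (M w) < N.+1)%N.
  by move=> zM; apply: leq_trans (M_size w); rewrite index_mem.
by rewrite !inordK ?idx//; exact: index_inj.
Qed.

Lemma synthesis_gather w f :
  synthesis rs (gather L M slot_of w f) (kappa w) =
  \sum_(y <- M w) ((wt y)%:C * f y) *: site (rs (kappa w)) (index y (M w)).
Proof.
rewrite /synthesis; under eq_bigr do rewrite mxE scaler_suml.
rewrite exchange_big /= !big_seq; apply: eq_bigr => y yM.
have yN : (index y (M w) < N.+1)%N by apply: leq_trans (M_size w); rewrite index_mem.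
rewrite (bigD1 (inord (index y (M w))))//= eqxx mul1r inordK// big1 ?addr0// => i iy.
rewrite (_ : (_ == _) = false) ?mul0r ?scale0r//.
by apply/negbTE; apply: contra iy => /eqP/enum_rank_inj[->].
Qed.

(** At the label [w] the matrix of [b] is read off at the representative set
[rs (kappa w)], points being matched by their positions. *)
Lemma compress_gather b w f x : linear b -> x \in M w ->
  compress rs b (gather L M slot_of w f) (slot_of w x) 0 =
  \sum_(y <- M w) (wt y)%:C * f y *
    l2dot (b (site (rs (kappa w)) (index y (M w))))
          (site (rs (kappa w)) (index x (M w))).
Proof.
move=> bl xM; have xN : (index x (M w) < N.+1)%N.
  by apply: leq_trans (M_size w); rewrite index_mem.
rewrite mxE /cell enum_rankK /= inordK// synthesis_gather.
by rewrite (linear_sumZ _ _ _ bl) l2dot_suml.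
Qed.

Section Band.
Variables (b : ell2 R X -> ell2 R X) (P P' : X -> {fset X}) (D : nat) (B eta delt : R).
Hypothesis b_bounded : bounded_operators l2dot b.
Hypothesis PP' : forall x y, (y \in P x) = (x \in P' y).
Hypothesis P_size : forall x, (#|` P x| <= D)%N.
Hypothesis P'_size : forall x, (#|` P' x| <= D)%N.
Hypothesis b_band : forall x y, y \notin P x -> l2dot (b (delta y)) (delta x) = 0.
Hypothesis B_ge0 : 0 <= B.
Hypothesis b_le : forall x y, normc (l2dot (b (delta y)) (delta x)) <= B.
Hypothesis eta_ge0 : 0 <= eta.
Hypothesis delt_ge0 : 0 <= delt.
(* The compressions to [M w] and to the representative of its class agree up to
   [eta], entry by entry. *)
Hypothesis b_site : forall w x y, x \in M w -> y \in M w ->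
  normc (l2dot (b (site (rs (kappa w)) (index y (M w))))
               (site (rs (kappa w)) (index x (M w))) -
         l2dot (b (delta y)) (delta x)) <= eta.
Hypothesis kernel_near1 : forall x y, y \in P x ->
  `|wt x * wt y * #|` (L x `&` L y)%fset|%:R - 1| <= delt.

Let entry x y := l2dot (b (delta y)) (delta x).
Let mass w f : R := \sum_(y <- M w) wt y * normc (f y).
Let rowmass x f : R := \sum_(y <- P x) normc (f y).
(* The Schur multiplier with the normalized overlaps as entries, applied to [b] and
   [f]: what [spread] would give if each label kept its own block. *)
Let multiplied x f := (wt x)%:C * \sum_(w <- L x) \sum_(y <- M w) (wt y)%:C * f y * entry x y.

Lemma multipliedE x f : multiplied x f =
  \sum_(y <- P x) (wt x * wt y * #|` (L x `&` L y)%fset|%:R)%:C * (entry x y * f y).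
Proof.
rewrite /multiplied.
pose g y := (wt y)%:C * f y * entry x y.
have restrict w : \sum_(y <- M w) g y = \sum_(y <- P x | w \in L y) g y.
  transitivity (\sum_(y <- (M w `&` P x)%fset) g y).
    apply/esym/big_fset_incl => [|y yM]; first exact: fsubsetIl.
    by rewrite in_fsetI yM /= => yP; rewrite /g /entry b_band// mulr0.
  have -> : (M w `&` P x)%fset = [fset y in P x | w \in L y]%fset; last first.
    by rewrite [RHS]big_fset_condE.
  by apply/fsetP => y; rewrite !inE /= LM andbC.
under eq_bigr do rewrite restrict big_mkcond.
rewrite exchange_big mulr_sumr; apply: eq_bigr => y _.
rewrite -big_mkcond big_fset_condE /=.
have -> : [fset w | w in L x & w \in L y]%fset = (L x `&` L y)%fset.
  by apply/fsetP => w; rewrite !inE.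
rewrite big_const_seq count_predT iter_addr_0 /g !real_complexM.
by rewrite -[_ *+ _ in LHS]mulr_natr (rmorph_nat (real_complex R)); ring.
Qed.

(** Bounds the error due to the representatives. The constant is the size of the
sets [M w], one square root for each of the two directions in which the block is
crossed. *)
Lemma smear_le f : (\esum_(x in [set: X]) ((wt x * \sum_(w <- L x) mass w f) ^+ 2)%:E
   <= ((N.+1%:R * norm2 f) ^+ 2)%:E)%E.
Proof.
apply: (le_trans (averaging_le LM L_neq0 (fun _ w => mass w f))).
rewrite exprMn EFinM -(esum_weight LM L_neq0) -esumZ ?sqr_ge0//; last first.
  by move=> w; apply: sumr_ge0 => x _; exact: sqr_ge0.
apply: le_esum => w _; rewrite lee_fin big_const_seq count_predT iter_addr_0.
rewrite -[leLHS]mulr_natl [N.+1%:R ^+ 2]expr2 -mulrA.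
have sq0 : 0 <= \sum_(x <- M w) (wt x * normc (f x)) ^+ 2.
  by apply: sumr_ge0 => x _; exact: sqr_ge0.
apply: ler_pM; rewrite ?ler0n ?sqr_ge0 ?ler_nat ?M_size//.
by apply: (le_trans (sqr_sum_le _ _)); rewrite ler_wpM2r// ler_nat M_size.
Qed.

(** Schur's test, for a matrix of zeros and ones with at most [D] ones in each
row and each column. *)
Lemma rowmass_le f :
  (\esum_(x in [set: X]) (rowmass x f ^+ 2)%:E <= ((D%:R * norm2 f) ^+ 2)%:E)%E.
Proof.
apply: (@le_trans _ _
  (\esum_(x in [set: X]) (D%:R * \sum_(y <- P x) normc (f y) ^+ 2)%:E)%E).
  apply: le_esum => x _; rewrite lee_fin; apply: (le_trans (sqr_sum_le _ _)).
  rewrite ler_wpM2r ?ler_nat ?P_size// sumr_ge0// => y _; exact: sqr_ge0.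
rewrite esumZ ?ler0n//; last by move=> x; apply: sumr_ge0 => y _; exact: sqr_ge0.
rewrite exprMn expr2 -mulrA EFinM; apply: lee_wpmul2l; first by rewrite lee_fin.
rewrite (esum_exchange PP') => [|x y]; last exact: sqr_ge0.
rewrite EFinM -esum_hnorm -esumZ ?ler0n//; last by move=> x; exact: sqr_ge0.
apply: le_esum => y _; rewrite lee_fin big_const_seq count_predT iter_addr_0.
by rewrite -[leLHS]mulr_natl ler_wpM2r ?sqr_ge0 ?ler_nat ?P'_size.
Qed.

Lemma approx_pointwise f x :
  normc ((spread L M slot_of (compress rs b) f - b f) x) <=
  eta * (wt x * \sum_(w <- L x) mass w f) + delt * B * rowmass x f.
Proof.
have [bl _] := b_bounded.
rewrite ell2BE (spreadE LM L_neq0 slot_of_inj); last exact: compress_matrix.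
rewrite (row_expansion f b_bounded (b_band (x := x))).
rewrite -[_ - _](subrKA (multiplied x f)).
apply: (le_trans (le_normcD _ _)); apply: lerD.
  rewrite /multiplied /spread_fun -mulrBr normcM normc_real ger0_norm ?weight_ge0//.
  rewrite mulrCA ler_wpM2l ?weight_ge0// -sumrB mulr_sumr.
  apply: (le_trans (normc_sum_le _ _)); rewrite !big_seq; apply: ler_sum => w.
  rewrite LM => xM; rewrite compress_gather// -sumrB /mass mulr_sumr.
  apply: (le_trans (normc_sum_le _ _)); rewrite !big_seq; apply: ler_sum => y yM.
  rewrite -mulrBr 2!normcM normc_real ger0_norm ?weight_ge0// mulrC.
  by rewrite ler_wpM2r ?mulr_ge0 ?weight_ge0 ?normc_ge0//; exact: b_site.
rewrite multipliedE -sumrB /rowmass mulr_sumr.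
apply: (le_trans (normc_sum_le _ _)); rewrite !big_seq; apply: ler_sum => y yP.
rewrite -[X in _ - X]mul1r -mulrBl -(rmorph1 (real_complex R)) -rmorphB.
rewrite 2!normcM normc_real mulrA ler_wpM2r ?normc_ge0//.
by apply: ler_pM; rewrite ?normr_ge0 ?normc_ge0//; [exact: kernel_near1|exact: b_le].
Qed.

Lemma approx_le f : norm2 (spread L M slot_of (compress rs b) f - b f) <=
  2 * (eta * N.+1%:R + delt * B * D%:R) * norm2 f.
Proof.
set U := eta * _; set V := delt * B * _.
have U0 : 0 <= U by rewrite mulr_ge0.
have V0 : 0 <= V by rewrite !mulr_ge0.
apply: hnorm_le; first by rewrite !mulr_ge0 ?addr_ge0 ?hnorm_ge0.
pose E x := wt x * \sum_(w <- L x) mass w f.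
apply: (@le_trans _ _ (\esum_(x in [set: X])
  ((2 * eta ^+ 2 * E x ^+ 2)%:E + (2 * (delt * B) ^+ 2 * rowmass x f ^+ 2)%:E))%E).
  apply: le_esum => x _; rewrite -EFinD lee_fin.
  have mass0 : 0 <= E x.
    by rewrite mulr_ge0 ?weight_ge0 ?sumr_ge0// => w _; rewrite sumr_ge0// => y _;
      rewrite mulr_ge0 ?weight_ge0 ?normc_ge0.
  have row0 : 0 <= rowmass x f by rewrite sumr_ge0// => y _; exact: normc_ge0.
  have sqr2 (p q : R) : (p + q) ^+ 2 <= 2 * p ^+ 2 + 2 * q ^+ 2.
    by have := sqr_ge0 (p - q); nra.
  apply: (@le_trans _ _ ((eta * E x + delt * B * rowmass x f) ^+ 2)).
    have sum0 : 0 <= eta * E x + delt * B * rowmass x f.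
      by apply: addr_ge0; apply: mulr_ge0 => //; exact: mulr_ge0.
    by apply: lerXn2r; rewrite ?nnegrE ?normc_ge0//; exact: approx_pointwise.
  by apply: (le_trans (sqr2 _ _)); rewrite le_eqVlt; apply/orP; left; apply/eqP; ring.
rewrite esumD; try by move=> x _; rewrite lee_fin mulr_ge0 ?sqr_ge0// mulr_ge0 ?sqr_ge0.
rewrite !esumZ ?mulr_ge0 ?sqr_ge0//; try by move=> x; exact: sqr_ge0.
have c1 : (0 <= (2 * eta ^+ 2)%:E)%E by rewrite lee_fin mulr_ge0 ?sqr_ge0.
have c2 : (0 <= (2 * (delt * B) ^+ 2)%:E)%E by rewrite lee_fin mulr_ge0 ?sqr_ge0.
apply: (le_trans (leeD (lee_wpmul2l c1 (smear_le f)) (lee_wpmul2l c2 (rowmass_le f)))).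
rewrite -!EFinM -EFinD lee_fin.
have h0 := sqr_ge0 (norm2 f).
rewrite -[leLHS]/(2 * eta ^+ 2 * (N.+1%:R * norm2 f) ^+ 2 + 2 * (delt * B) ^+ 2 * (D%:R * norm2 f) ^+ 2).
have -> : 2 * eta ^+ 2 * (N.+1%:R * norm2 f) ^+ 2 + 2 * (delt * B) ^+ 2 * (D%:R * norm2 f) ^+ 2
  = (2 * U ^+ 2 + 2 * V ^+ 2) * norm2 f ^+ 2 by rewrite /U /V; ring.
move: U0 V0; move: U V => U V U0 V0; rewrite [leRHS]exprMn ler_wpM2r//.
by have := mulr_ge0 U0 V0; have := sqr_ge0 U; have := sqr_ge0 V; nra.
Qed.

End Band.
End Approximation.

(** * Finite partitions, coarse structures and property A *)

(** The classes are the cells of a grid of mesh [e]. *)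
Lemma rounding (R : realType) (W : Type) (J : finType) (h : W -> J -> R) (beta e : R) :
  0 < e -> (forall w j, `|h w j| <= beta) ->
  exists (K : finType) (kappa : W -> K), (0 < #|K|)%N /\
    forall w w' j, kappa w = kappa w' -> `|h w j - h w' j| <= e.
Proof.
move=> e0 hb; pose step w j := (h w j + beta) / e.
have step0 w j : 0 <= step w j.
  apply: divr_ge0 (ltW e0); have := hb w j; rewrite ler_norml => /andP[]; lra.
pose n := Num.truncn ((beta + beta) / e).
have stepn w j : (Num.truncn (step w j) < n.+1)%N.
  rewrite ltnS; apply: le_truncn; rewrite ler_pM2r ?invr_gt0// lerD2r.
  by apply: le_trans (hb w j); exact: ler_norm.
exists {ffun J -> 'I_n.+1}, (fun w => [ffun j => inord (Num.truncn (step w j))]).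
split; first by apply/card_gt0P; exists [ffun=> ord0].
move=> w w' j /ffunP/(_ j); rewrite !ffunE => /(congr1 val) /=.
rewrite !inordK// => same.
have /andP[l1 u1] := truncn_itv (step0 w j).
have /andP[l2 u2] := truncn_itv (step0 w' j).
rewrite same -natr1 in l1 u1; rewrite -natr1 in u2.
have -> : h w j - h w' j = (step w j - step w' j) * e.
  by rewrite /step -mulrBl divfK ?gt_eqF//; ring.
rewrite normrM (gtr0_norm e0) -[leRHS]mul1r ler_pM2r// ler_norml.
by apply/andP; split; lra.
Qed.

Lemma complex_rounding (R : realType) (W : Type) (J : finType)
    (z : W -> J -> R[i]) (beta e : R) :
  0 < e -> (forall w j, normc (z w j) <= beta) ->
  exists (K : finType) (kappa : W -> K), (0 < #|K|)%N /\
    forall w w' j, kappa w = kappa w' -> normc (z w j - z w' j) <= e.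
Proof.
move=> e0 zb.
pose h w (jb : J * bool) := if jb.2 then complex.Re (z w jb.1) else complex.Im (z w jb.1).
have [|w [j []]|K [kappa [K0 hK]]] := @rounding R W _ h beta (e / 2).
- by rewrite divr_gt0.
- exact: le_trans (ler_Re_normc _) (zb _ _).
- exact: le_trans (ler_Im_normc _) (zb _ _).
exists K, kappa; split=> // w w' j ww'.
have := hK w w' (j, true) ww'; have := hK w w' (j, false) ww'; rewrite /h /=.
have -> : complex.Re (z w j) - complex.Re (z w' j) = complex.Re (z w j - z w' j).
  by case: (z w j) => ? ?; case: (z w' j).
have -> : complex.Im (z w j) - complex.Im (z w' j) = complex.Im (z w j - z w' j).
  by case: (z w j) => ? ?; case: (z w' j).
move=> imle rele.
rewrite -(@ler_pXn2r _ 2)// ?nnegrE ?normc_ge0 ?(ltW e0)// sqr_normcE.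
rewrite -(real_normK (num_real (complex.Re _))) -(real_normK (num_real (complex.Im _))).
have : forall p q : R, 0 <= p -> 0 <= q -> p <= e / 2 -> q <= e / 2 -> p ^+ 2 + q ^+ 2 <= e ^+ 2.
  by move=> p q p0 q0 pe qe; nra.
by apply; rewrite ?normr_ge0.
Qed.

Section CoarseFacts.
Context {X : choiceType} (C : set (set (X * X))).
Hypothesis hC : coarse_structure C.

Lemma coarse_bigU (I : Type) (s : seq I) (T : I -> set (X * X)) :
  (forall i, C (T i)) -> C (\big[setU/diagonal]_(i <- s) T i).
Proof.
move=> CT; elim: s => [|i s IH]; first by rewrite big_nil; exact: coarse_diagonal.
by rewrite big_cons; exact: coarse_union.
Qed.

Lemma coarse_section_fset : uniformly_locally_finite C ->
  forall T, C T -> exists (P : X -> {fset X}) (N : nat),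
    (forall x y, (x \in P y) = ((x, y) \in T)) /\ forall y, (#|` P y| <= N)%N.
Proof.
move=> ulf T CT; have [N TN] := ulf T CT.
exists (fun y => fset_set (ysection T y)), N; split=> [x y|y]; last exact: geq_card_fset_set.
rewrite in_fset_set; last by apply/finite_set_leP; exists N.
exact: mem_ysection.
Qed.

End CoarseFacts.

(** The normalized overlap is at most 1 because the intersection is at most as large as either
set, and at least [1 / (1 + e)] because each set has at most [(1 + e)] times the size
of the intersection. *)
Lemma overlap_near1 (R : realType) (X W : choiceType) (L : X -> {fset W}) x y (e : R) :
  0 < e -> L x != fset0 -> L y != fset0 ->
  #|` ((L x `\` L y) `|` (L y `\` L x))%fset|%:R < e * #|` (L x `&` L y)%fset|%:R ->
  `|weight L x * weight L y * #|` (L x `&` L y)%fset|%:R - 1| <= e.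
Proof.
move=> e0 Lx Ly close.
set I := #|` (L x `&` L y)%fset|%:R in close *.
set a : R := #|` L x|%:R; set b : R := #|` L y|%:R.
have a0 : 0 < a by rewrite ltr0n cardfs_gt0.
have b0 : 0 < b by rewrite ltr0n cardfs_gt0.
have Ia : I <= a by rewrite ler_nat fsubset_leq_card ?fsubsetIl.
have Ib : I <= b by rewrite ler_nat fsubset_leq_card ?fsubsetIr.
have aI : a <= (1 + e) * I.
  have : a <= I + #|` ((L x `\` L y) `|` (L y `\` L x))%fset|%:R.
    rewrite -natrD ler_nat -(cardfsID (L y) (L x)) leq_add2l.
    by rewrite fsubset_leq_card ?fsubsetUl.
  lra.
have bI : b <= (1 + e) * I.
  have : b <= I + #|` ((L x `\` L y) `|` (L y `\` L x))%fset|%:R.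
    rewrite -natrD ler_nat -(cardfsID (L x) (L y)) fsetIC leq_add2l.
    by rewrite fsubset_leq_card ?fsubsetUr.
  lra.
set p : R := weight L x; set q : R := weight L y.
have p0 : 0 <= p := weight_ge0 _ _; have q0 : 0 <= q := weight_ge0 _ _.
have pa : p ^+ 2 * a = 1 by rewrite /p /weight exprVn sqr_sqrtr ?mulVf ?gt_eqF ?ltW.
have qb : q ^+ 2 * b = 1 by rewrite /q /weight exprVn sqr_sqrtr ?mulVf ?gt_eqF ?ltW.
have I0 : 0 < I.
  by move: aI; rewrite -(pmulr_rgt0 I (_ : 0 < 1 + e)) ?addr_gt0//; exact: lt_le_trans.
have up : p * q * I <= 1.
  rewrite -(@ler_pXn2r _ 2)// ?nnegrE ?mulr_ge0 ?(ltW I0)// expr1n !exprMn.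
  have -> : 1 = (p ^+ 2 * a) * (q ^+ 2 * b) :> R by rewrite pa qb mulr1.
  rewrite [leRHS]mulrACA; apply: ler_wpM2l; first by rewrite mulr_ge0 ?sqr_ge0.
  by rewrite expr2; apply: ler_pM => //; exact: ltW.
have lo : 1 <= (1 + e) * (p * q * I).
  have e1 : 0 <= 1 + e by rewrite addr_ge0 ?ltW.
  rewrite -(@ler_pXn2r _ 2)// ?nnegrE ?mulr_ge0 ?(ltW I0)// expr1n.
  have pq1 : (p ^+ 2 * q ^+ 2) * (a * b) = 1 by rewrite mulrACA pa qb mulr1.
  rewrite -[leLHS]pq1.
  have -> : ((1 + e) * (p * q * I)) ^+ 2 =
     (p ^+ 2 * q ^+ 2) * (((1 + e) * I) * ((1 + e) * I)) by ring.
  apply: ler_wpM2l; first by rewrite mulr_ge0 ?sqr_ge0.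
  by apply: ler_pM => //; exact: ltW.
move: up lo; set t := p * q * I => up lo; rewrite ler_norml; apply/andP; split; nra.
Qed.

Section RoeAlgebra.
Context {R : realType} {X : choiceType} (C : set (set (X * X))).
Hypothesis hC : coarse_structure C.

(** Two points share a label only if both are [S]-related to its first
component: this bounds the sets [M w] and puts the pairs with a common label in
[S] composed with its inverse. *)
Lemma propertyA_kernel (T : set (X * X)) (e : R) :
  uniformly_locally_finite C -> propertyA R C -> 0 < e -> C T ->
  exists (L : X -> {fset X * nat}) (M : X * nat -> {fset X}) (N : nat),
    [/\ (forall x w, (w \in L x) = (x \in M w)) /\ (forall w, (#|` M w| <= N)%N),
        forall x, L x != fset0,
        C [set p | exists w, w \in L p.1 /\ w \in L p.2] &
        forall x y, T (x, y) ->
          `|weight L x * weight L y * #|` (L x `&` L y)%fset|%:R - 1| <= e].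
Proof.
move=> ulf pA e0 CT; have [S [A [[CS AS] Afin Adiag Aclose]]] := pA e T e0 CT.
have [P [N [PS PN]]] := coarse_section_fset ulf CS.
have Lin x w : (w \in fset_set (slice A x)) = ((x, w.1, w.2) \in A).
  by rewrite in_fset_set//; apply/idP/idP; rewrite !inE.
have Lne x : fset_set (slice A x) != fset0.
  by apply/fset0Pn; exists (x, 1%N); rewrite Lin inE; exact: Adiag.
exists (fun x => fset_set (slice A x)).
exists (fun w => [fset x in P w.1 | (x, w.1, w.2) \in A]%fset), N; split.
- split=> [x w|w].
    rewrite Lin !inE /= PS; apply/idP/andP => [xA|[]//]; split=> //.
    by rewrite inE in xA; rewrite inE; have [] := AS _ xA.
  by apply: leq_trans (PN w.1); apply/fsubset_leq_card/fset_sub.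
- exact: Lne.
- apply: (coarse_sub hC _ (coarse_comp hC CS (coarse_inv hC CS))) => -[x y] /=.
  move=> [w []]; rewrite !Lin !inE => wx wy; exists w.1.
  by have [] := AS _ wx; have [] := AS _ wy.
- move=> x y Txy; apply: overlap_near1 => //.
  by have := Aclose x y Txy; rewrite fset_setI// fset_setU ?fset_setD//; exact: finite_setD.
Qed.

Lemma band_roe T a : C T -> band_operators R T a -> uniform_roe_algebra R C a.
Proof.
move=> CT aT; split=> [|e e0]; first by case: aT.
exists T, a; split=> //; rewrite subrr; apply: le_lt_trans (_ : 0%:E < e%:E)%E => //.
by apply: opnorm_le => // f; rewrite mul0r hnorm0.
Qed.

Lemma compress_ccp (K : finType) (N : nat) (rs : K -> {fset X})
    (A : set (ell2 R X -> ell2 R X)) :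
  (forall t, (#|` rs t| <= N.+1)%N) -> (forall a, A a -> linear a) ->
  contractive_completely_positive l2dot (cvdot #|{: K * 'I_N.+1}|) A
    (matrix_algebra R _) (compress rs).
Proof.
move=> rsN Al; split=> [a /Al|c a b _ _|n a _|a /Al].
- exact: compress_matrix.
- exact: compressP.
- exact: compress_positive.
- exact: opnorm_compress_le.
Qed.

Lemma spreadP (W : choiceType) (L : X -> {fset W}) (M : W -> {fset X}) k
    (slot : W -> X -> 'I_k) (c : R[i]) g h :
  (forall x w, (w \in L x) = (x \in M w)) -> (forall x, L x != fset0) ->
  (forall w, {in M w &, injective (slot w)}) ->
  matrix_algebra R k g -> matrix_algebra R k h ->
  spread L M slot (c *: g + h) = c *: spread L M slot g + spread L M slot h.
Proof.
move=> LM L0 inj gM hM; apply/funext => f; apply/val_inj/funext => x.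
rewrite -[RHS]/(c * spread L M slot g f x + spread L M slot h f x).
rewrite [LHS](spreadE LM L0 inj); last first.
  have gl := matrix_algebra_linear gM; have hl := matrix_algebra_linear hM.
  apply: mx_linearE => d u v; rewrite -[LHS]/(c *: g _ + h _) gl hl.
  rewrite -[(c *: g + h) u]/(c *: g u + h u) -[(c *: g + h) v]/(c *: g v + h v).
  by rewrite !scalerDr !scalerA [c * d]mulrC addrACA.
rewrite !(spreadE LM L0 inj)// /spread_fun mulrCA -mulrDr; congr (_ * _).
rewrite mulr_sumr -big_split; apply: eq_bigr => w _.
by rewrite -[(c *: g + h) _]/(c *: g _ + h _) !mxE.
Qed.

Lemma spread_ccp (W : choiceType) (L : X -> {fset W}) (M : W -> {fset X}) k
    (slot : W -> X -> 'I_k) :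
  (forall x w, (w \in L x) = (x \in M w)) -> (forall x, L x != fset0) ->
  (forall w, {in M w &, injective (slot w)}) ->
  C [set p | exists w, w \in L p.1 /\ w \in L p.2] ->
  contractive_completely_positive (cvdot k) l2dot (matrix_algebra R k)
    (uniform_roe_algebra R C) (spread L M slot).
Proof.
move=> LM L0 inj CL; split=> [g gM|c g h gM hM|n g|g gM].
- exact: (band_roe CL (spread_band LM L0 inj gM)).
- exact: spreadP.
- exact: spread_positive.
- exact: opnorm_spread_le.
Qed.

(** The usual three-term estimate: [theta a - a] is [theta (a - b)], plus
[theta b - b], plus [b - a]. *)
Lemma opnorm_perturbation (theta : (ell2 R X -> ell2 R X) -> (ell2 R X -> ell2 R X))
    (a b : ell2 R X -> ell2 R X) (r s : R) :
  theta a = theta (a - b) + theta b ->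
  (opnorm l2dot (theta (a - b)%R) <= opnorm l2dot (a - b)%R)%E ->
  bounded_operators l2dot a -> bounded_operators l2dot b ->
  linear (theta (a - b)) ->
  (opnorm l2dot (a - b)%R < r%:E)%E -> 0 <= s ->
  (forall f, hnorm l2dot (theta b f - b f) <= s * hnorm l2dot f) ->
  (opnorm l2dot (theta a - a)%R <= (r + r + s)%:E)%E.
Proof.
move=> tD tc [al _] [bl _] tl abr s0 tb.
have abl := linear_sub al bl.
have r0 : 0 <= r by rewrite -lee_fin; exact: le_trans (opnorm_ge0 _ _) (ltW abr).
apply: opnorm_le => [|f]; first by rewrite !addr_ge0.
have -> : (theta a - a) f = theta (a - b) f + (theta b f - b f) + (-1) *: (a - b) f.
  rewrite tD -[LHS]/(theta (a - b) f + theta b f - a f) -[(a - b) f]/(a f - b f).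
  rewrite scaleN1r opprB !addrA; congr (_ - _).
  by rewrite -[RHS]addrA addNr addr0.
apply: (le_trans (ler_hnormD _ _ _)).
rewrite hnormZ normcN normc1 mul1r !mulrDl [leRHS]addrAC.
apply: lerD; last by apply: opnorm_bound => //; exact: ltW.
apply: (le_trans (ler_hnormD _ _ _)); apply: lerD (tb f).
by apply: opnorm_bound => //; exact: le_trans tc (ltW abr).
Qed.

End RoeAlgebra.

(** * Nuclearity *)

Theorem theorem4p2 (R : realType) (X : choiceType) (C : set (set (X * X)))
    (hC : coarse_structure C) (hulf : uniformly_locally_finite C)
    (hA : propertyA R C) :
  nuclear l2dot (uniform_roe_algebra R C).
Proof.
move=> F eps /finite_seqP[s ->] FA eps0.
(* Each operator of the list is replaced by a band operator at distance eps / 4,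
   and a single controlled set [T] serves all of them. *)
have e4 : 0 < eps / 4 by rewrite divr_gt0.
have /choice[bT bTP] : forall i : 'I_(size s), exists p : (ell2 R X -> ell2 R X) * set (X * X),
    [/\ C p.2, band_operators R p.2 p.1 &
      (opnorm l2dot (tnth (in_tuple s) i - p.1)%R < (eps / 4)%:E)%E].
  move=> i; have [_ /(_ _ e4)[T [b [CT bT ab]]]] := FA _ (mem_tnth i (in_tuple s)).
  by exists (b, T).
pose b i := (bT i).1.
pose T := \big[setU/diagonal]_i (bT i).2.
have CT : C T by apply: coarse_bigU => // i; have [] := bTP i.
have subT i : (bT i).2 `<=` T.
  by rewrite /T (bigD1 i)//=; exact: subsetUl.
have b_bounded i : bounded_operators l2dot (b i) by have [_ []] := bTP i.
have [P' [D1 [P'T P'D]]] := coarse_section_fset hulf CT.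
have [P [D2 [PT PD]]] := coarse_section_fset hulf (coarse_inv hC CT).
pose D := maxn D1 D2.
have PP' x y : (y \in P x) = (x \in P' y).
  by rewrite PT P'T; apply/idP/idP; rewrite !inE.
have b_band i x y : y \notin P x -> l2dot (b i (delta y)) (delta x) = 0.
  rewrite PP' P'T => nT; have [_ [_ bb] _] := bTP i; apply: bb => /subT xyT.
  by move/negP: nT; apply; rewrite inE.
have /choice[beta betaP] : forall i, exists r : R, 0 <= r /\
    forall f, hnorm l2dot (b i f) <= r * hnorm l2dot f.
  by move=> i; have [bl /(bounded_opP bl)[r _ rP]] := b_bounded i; exists r.
pose B := \sum_i beta i.
have B0 : 0 <= B by apply: sumr_ge0 => i _; exact: (betaP i).1.
have betaB i : beta i <= B.
  by rewrite /B (bigD1 i)//= lerDl sumr_ge0// => j _; exact: (betaP j).1.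
have b_hnorm i f : hnorm l2dot (b i f) <= B * hnorm l2dot f.
  by apply: le_trans ((betaP i).2 f) _; rewrite ler_wpM2r ?hnorm_ge0.
(* [delt] is fixed before property A is applied, as it only depends on [eps],
   [T] and the norms of the [b i]; [eta] has to compensate the size [N] of the blocks,
   which depends on [delt]. *)
pose delt := eps / 16 / ((B + 1) * D.+1%:R).
have delt0 : 0 < delt by rewrite !divr_gt0// mulr_gt0// ltr_wpDl.
have [L [M [N [[LM MN] Lne CL near1]]]] := propertyA_kernel hC hulf hA delt0 CT.
pose eta := eps / 16 / N.+1%:R.
have eta0 : 0 < eta by rewrite !divr_gt0.
have MN1 w : (#|` M w| <= N.+1)%N by exact: leqW.
have entry_le i (A : {fset X}) p q :
    normc (l2dot (b i (site A p)) (site A q)) <= B.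
  apply: le_trans (l2dot_site_le _ _ _) _; apply: le_trans (b_hnorm _ _) _.
  by rewrite -[leRHS]mulr1 ler_wpM2l// hnorm_site_le.
pose z w (j : 'I_(size s) * 'I_N.+1 * 'I_N.+1) :=
  l2dot (b j.1.1 (site (M w) j.1.2)) (site (M w) j.2).
have [K [kappa [K0 kappaP]]] :=
  complex_rounding eta0 (fun w j => entry_le j.1.1 (M w) j.1.2 j.2 : normc (z w j) <= B).
(* A cell of the grid that is met by no label gets an empty block. *)
pose rep (t : K) : {fset X} :=
  if pselect (exists w, kappa w = t) is left e then M (projT1 (cid e)) else fset0.
have repN t : (#|` rep t| <= N.+1)%N.
  by rewrite /rep; case: pselect => [e|_]; rewrite ?cardfs0.
have repP w : exists2 w', kappa w = kappa w' & rep (kappa w) = M w'.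
  rewrite /rep; case: pselect => [e|[]]; last by exists w.
  by exists (projT1 (cid e)) => //; rewrite (projT2 (cid e)).
pose phi := compress (R := R) (N := N) rep.
pose slot := slot_of (N := N) M kappa.
have inj := slot_of_inj MN1 (kappa := kappa).
pose psi := spread (R := R) L M slot.
exists #|{: K * 'I_N.+1}|, phi, psi; split.
- by rewrite card_prod card_ord muln_gt0 K0.
- by apply: compress_ccp => // a [[]].
- exact: spread_ccp.
move=> c cs; have /tnthP[i ->] : c \in in_tuple s by exact: cs.
set a := tnth _ i.
have a_bounded : bounded_operators l2dot a by have [] := FA _ (mem_tnth i (in_tuple s)).
have [al _] := a_bounded; have [bl _] := b_bounded i.
have [_ _ ab] := bTP i; rewrite -/a -/(b i) in ab.
have abl : linear (a - b i) by exact: linear_sub.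
have phiM h : linear h -> matrix_algebra R _ (phi h) by exact: compress_matrix.
pose err := 2 * (eta * N.+1%:R + delt * B * D%:R).
have [eta_ge0 delt_ge0] := (ltW eta0, ltW delt0).
have err0 : 0 <= err.
  by apply: mulr_ge0 => //; apply: addr_ge0; apply: mulr_ge0 => //; exact: mulr_ge0.
have approx f : hnorm l2dot (psi (phi (b i)) f - b i f) <= err * hnorm l2dot f.
  apply: (approx_le LM Lne MN1 (b_bounded i) PP' _ _ (@b_band i)) => //.
  - by move=> x; apply: leq_trans (PD x) (leq_maxr _ _).
  - by move=> x; apply: leq_trans (P'D x) (leq_maxl _ _).
  - move=> x y; apply: le_trans (normc_l2dot_delta_le _ _) _.
    by apply: le_trans (b_hnorm _ _) _; rewrite hnorm_delta mulr1.
  - move=> w x y xM yM; have [w' ww' ->] := repP w.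
    have idx u : u \in M w -> (index u (M w) < N.+1)%N.
      by move=> uM; apply: leq_trans (MN1 w); rewrite index_mem.
    have := kappaP w' w (i, inord (index y (M w)), inord (index x (M w))) (esym ww').
    by rewrite /z /= !inordK ?idx// !site_index.
  - by move=> x y; rewrite PP' P'T inE => /near1.
have err_le : err <= eps / 4.
  rewrite /err; have -> : eta * N.+1%:R = eps / 16 by rewrite /eta divfK// pnatr_eq0.
  have dB : delt * B * D%:R <= eps / 16.
    have B1 : 0 < B + 1 by rewrite ltr_wpDl.
    have D1' : 0 < D.+1%:R :> R by [].
    have -> : eps / 16 = delt * ((B + 1) * D.+1%:R).
      by rewrite /delt divfK// mulf_neq0// gt_eqF.
    rewrite -mulrA ler_wpM2l ?(ltW delt0)//.
    by apply: ler_pM => //; rewrite ?ler0n ?ler_nat// lerDl.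
  by move: dB; lra.
have split_a : psi (phi a) = psi (phi (a - b i)) + psi (phi (b i)).
  rewrite -{1}(subrK (b i) a) -{1}[a - b i]scale1r /phi compressP.
  rewrite /psi spreadP ?scale1r//; exact: phiM.
have theta_le : (opnorm l2dot (psi (phi (a - b i)%R)) <= opnorm l2dot (a - b i)%R)%E.
  exact: le_trans (opnorm_spread_le LM Lne inj (phiM _ abl)) (opnorm_compress_le repN abl).
have theta_linear : linear (psi (phi (a - b i))).
  exact: (spread_linear LM Lne inj (phiM _ abl)).
apply: le_lt_trans (opnorm_perturbation (theta := psi \o phi) split_a theta_le a_bounded
  (b_bounded i) theta_linear ab err0 approx) _.
by rewrite lte_fin; lra.
Qed.
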